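(* Let $d\ge 2$, $n\ge 1$, $\mathbb K\in\{\mathbb R,\mathbb C\}$, $q=\frac{2d}{d+1}$, and let $T:(\mathbb K^n)^d\to\mathbb K$ be a nonzero $d$-linear form. Then $\|T\|_q=\|T\|_{\mathrm{cb}}$ if and only if there are an integer $1\le m\le n$, sets $J_1,\ldots,J_d\subseteq[n]$ with $|J_1|=\cdots=|J_d|=m$, a scalar $\lambda\in\mathbb K$ with $\lambda\ne0$, and Hadamard matrices $G_r$ over $\mathbb K$ indexed by $J_r\times J_{r+1}$ ($1\le r\le d-1$) such that \[ T(e_{i_1},\ldots,e_{i_d}) =\begin{cases} \displaystyle\lambda\prod_{r=1}^{d-1}G_r(i_r,i_{r+1}), &(i_1,\ldots,i_d)\in J_1\times\cdots\times J_d,\\[4pt] 0,&\text{otherwise.} \end{cases} \]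
   Context: $[n]=\{1,\dots,n\}$ and $e_1,\dots,e_n$ is the canonical basis of $\mathbb K^n$. The coefficient norm is $\|T\|_q=\big(\sum_{i_1,\ldots,i_d=1}^n|T(e_{i_1},\ldots,e_{i_d})|^q\big)^{1/q}$. The completely bounded norm is \[ \|T\|_{\mathrm{cb}}=\sup_{\mathcal H}\ \sup_{(X_j^s)}\Big\|\sum_{i_1,\ldots,i_d=1}^n T(e_{i_1},\ldots,e_{i_d})\,X^1_{i_1}X^2_{i_2}\cdots X^d_{i_d}\Big\|_{\mathcal B(\mathcal H)}, \] where $\mathcal H$ ranges over all Hilbert spaces over $\mathbb K$ and $(X_j^s)_{s\in[d],\,j\in[n]}$ over all families of bounded linear operators on $\mathcal H$ with operator norm $\le1$ (not necessarily commuting; products are compositions in the displayed order). A matrix $G$ with entries in $\mathbb K$, rows indexed by an $m$-element set $I$ and columns by an $m$-element set $I'$, is Hadamard (of order $m$, over $\mathbb K$) if all its entries have modulus $1$ and $GG^*=mI_m$, where $G^*$ is the transpose if $\mathbb K=\mathbb R$ and the conjugate transpose if $\mathbb K=\mathbb C$. *)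

(* Defs.v *)
From HB Require Import structures.
From mathcomp Require Import all_boot all_order all_algebra sesquilinear.
From mathcomp Require Import complex.
From mathcomp Require Import all_classical all_reals all_analysis.

Set Implicit Arguments.
Unset Strict Implicit.
Unset Printing Implicit Defensive.

Import Order.TTheory GRing.Theory Num.Theory.
Import numFieldNormedType.Exports.

Local Open Scope classical_set_scope.
Local Open Scope ring_scope.

(* Only the two instances below are used.  [reS] is needed because the norm of
   a normed module over K takes its values in K, hence in R[i] when K = R[i]:
   [reS `|x|] is that norm read as an element of R. *)
Record scalars (R : realType) := Scalars {
  scalar_field :> numFieldType;
  conjS : scalar_field -> scalar_field;
  reS : scalar_field -> R }.

Definition real_scalars (R : realType) : scalars R :=
  @Scalars R R idfun idfun.

Definition complex_scalars (R : realType) : scalars R :=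
  @Scalars R R[i] (@conjc R) (@complex.Re R).

Section Operators.
Variables (R : realType) (K : scalars R).

(* [dot] is linear in its first argument and conjugate-linear in its second. *)
Record hilbert := Hilbert {
  hilbert_space :> completeNormedModType K;
  dot : {dot hilbert_space for @conjS R K};
  dot_norm : forall x : hilbert_space, `|x| ^+ 2 = dot x x }.

Definition op_norm (H : hilbert) (A : H -> H) : \bar R :=
  ereal_sup [set (reS `|A x|)%:E | x in [set x : H | `|x| <= 1]].

End Operators.

Section MultilinearForms.
Variables (R : realType) (K : scalars R) (d n : nat).

(* A point of (K^n)^d is a finite function; slots and coordinates are numbered
   from 0. *)
Implicit Type T : {ffun 'I_d -> 'rV[K]_n} -> K.

Definition multilinear T :=
  forall (k : 'I_d) (x : {ffun 'I_d -> 'rV[K]_n}),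
    scalar (fun v : 'rV[K]_n => T [ffun s => if s == k then v else x s]).

Definition coef T (i : {ffun 'I_d -> 'I_n}) : K :=
  T [ffun s => delta_mx 0 (i s)].

Definition coef_norm (q : R) T : R :=
  (\sum_(i : {ffun 'I_d -> 'I_n}) reS `|coef T i| `^ q) `^ q^-1.

(* The big operator is the composite X_0 (i 0) \o ... \o X_(d-1) (i (d-1)). *)
Definition eval_ops T (H : hilbert K) (X : 'I_d -> 'I_n -> {linear H -> H})
    (v : H) : H :=
  \sum_(i : {ffun 'I_d -> 'I_n})
    coef T i *: (\big[(fun f g : H -> H => f \o g)/idfun]_(s < d)
                   (X s (i s) : H -> H)) v.

(* Boundedness of the operators X s j is implied by [op_norm (X s j) <= 1]. *)
Definition cb_norm T : \bar R :=
  ereal_sup [set r : \bar R | exists (H : hilbert K)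
      (X : 'I_d -> 'I_n -> {linear H -> H}),
    (forall s j, (op_norm (X s j) <= 1)%E) /\ r = op_norm (eval_ops T X)].

(* A matrix indexed by I x I' is given by the entries of G in I x I'; the
   other entries of G play no role.  The last clause is G G^* = m I_m. *)
Definition hadamard (m : nat) (I I' : {set 'I_n}) (G : 'M[K]_n) : Prop :=
  [/\ #|I| = m, #|I'| = m,
      (forall i j, i \in I -> j \in I' -> `|G i j| = 1)
    & (forall i k, i \in I -> k \in I ->
         \sum_(j in I') G i j * conjS (G k j) = (if i == k then m%:R else 0))].

End MultilinearForms.

(* Among d slots there are d.-1 pairs of consecutive ones; [slot_l r] and
   [slot_r r] are the slots number r and r.+1. *)
Definition slot_l (d : nat) (r : 'I_d.-1) : 'I_d := widen_ord (leq_pred d) r.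

Lemma slot_r_subproof (d : nat) (r : 'I_d.-1) : (r.+1 < d)%N.
Proof. by rewrite -ltn_predRL. Qed.

Definition slot_r (d : nat) (r : 'I_d.-1) : 'I_d :=
  Ordinal (slot_r_subproof r).

(* Main.v *)
Require Import Defs.
From HB Require Import structures.
From mathcomp Require Import all_boot all_order all_algebra sesquilinear complex.
From mathcomp Require Import all_classical all_reals all_analysis.
From mathcomp Require Import ring zify.

Set Implicit Arguments.
Unset Strict Implicit.
Unset Printing Implicit Defensive.
Import Order.TTheory GRing.Theory Num.Theory.
Import numFieldNormedType.Exports.
Local Open Scope classical_set_scope.
Local Open Scope ring_scope.

(** The idea.  Let [C] be the completely bounded norm of [T] and, for a slot [k]
and a letter [a], let [rho_k(a)] be the Euclidean norm of the subtensor of the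
coefficients whose index has the letter [a] in slot [k].

Lower bounds for [C] come from explicit operators on the Hilbert space whose
basis is the set of partial words.  Let the slots after [k] create letters and
the slots before [k] annihilate them.  The matrix coefficient of the resulting
sum at the empty word is then the sum over [a] of the pairings of [A_a] with
[B_a], where [A_a] is the subtensor for [a] read as a matrix (letters before
[k] against letters after [k]) and the [B_a] are arbitrary contractions.
Taking for [B_a] the entrywise conjugate of [A_a] divided by the square root
of the Hilbert-Schmidt norm of [A_a^* A_a] gives [sum_a rho_k(a) <= C]
([sum_slot_le]); in the case of equality each [A_a] has rank one
([sum_slot_eq]).

One application of the inequality between the arithmetic and geometric means
of [d + 1] weights, each of total mass at most one, turns these [d] bounds
into [|T|_q <= C] ([blei_le]); in the case of equality all weights coincide ([blei_eq]), and
this says that [|T|] is a constant times the indicator function of a product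
of [d] sets with the same number [m] of elements ([blei_eq_structure]).

If [|T|_q = C], both equality cases apply.  The rank-one condition says that
[T i * T i'] does not change when two words which agree in slot [k] exchange
their parts before [k] ([rank_one_slices_markov]).  As for a Markov chain, [T]
is then a product of functions of two consecutive letters
([markov_factorization]), all of constant modulus.  That these matrices have
orthogonal rows is seen from another choice of operators, of rank one in two
consecutive slots, which yields
[|sum_(x, y) G x y <y_y, x_x>| <= m^(3/2)] for all families of vectors [x_x]
and [y_y] of norm at most one ([chain_pairing_le]).  With the normalized
conjugate columns of [G] as [y_y] and the best possible [x_x], the left-hand
side exceeds [m^(3/2)] as soon as two rows are not orthogonal
([hadamard_of_pairing]).

Conversely [G G^* = m] bounds the operator norm of [G] by [sqrt m], also when
[G] acts on families of vectors ([hadamard_bounded]).  Alternating these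
matrices with the contractions of the successive slots gives
[C <= |lambda| m^((d+1)/2)], which is [|T|_q] ([cb_norm_chain_le],
[coef_norm_chain]). *)

(** * The two scalar fields *)

(** What the proof uses of the scalars, so that the real and the complex case are
treated together: an isometric copy [inR] of the reals in which the norm takes
its values, an involutive conjugation, and completeness, stated with real
radii. *)
Record scalar_theory (R : realType) (K : scalars R) := ScalarTheory {
  inR : {rmorphism R -> K};
  le_inR : {mono inR : a b / a <= b};
  reS_inR : cancel inR (@reS R K);
  inR_norm : forall x : K, inR (reS `|x|) = `|x|;
  conjSD : {morph @conjS R K : x y / x + y};
  conjSM : {morph @conjS R K : x y / x * y};
  mulconjS : forall x : K, x * conjS x = `|x| ^+ 2;
  conjSK : involutive (@conjS R K);
  conjS_inR : forall a, conjS (inR a) = inR a;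
  scalar_complete : forall F : set_system K, ProperFilter F ->
    (forall e, 0 < e -> exists x, F [set y : K | reS `|x - y| < e]) ->
    exists l, forall e, 0 < e -> F [set y : K | reS `|l - y| < e]
}.

Lemma real_complete (R : realType) (F : set_system R) : ProperFilter F ->
    (forall e, 0 < e -> exists x, F [set y : R | `|x - y| < e]) ->
    exists l, forall e, 0 < e -> F [set y : R | `|l - y| < e].
Proof.
move=> FF Fc.
have : cvg F.
  apply: cauchy_cvg; apply: cauchy_exP => e e0.
  by have [x Fx] := Fc _ e0; exists x.
move=> /cvg_ex [l Fl]; exists l => e e0.
by move/cvgrPdist_lt : Fl; apply.
Qed.

Lemma real_scalar_theory (R : realType) : scalar_theory (real_scalars R).
Proof.
exists (idfun : {rmorphism R -> R}) => //.
- by move=> x /=; rewrite -expr2 real_normK ?num_real.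
- by move=> F FF; exact: real_complete.
Qed.

(** The real and imaginary parts are 1-Lipschitz, so both images of the filter
converge in the reals. *)
Lemma complex_complete (R : realType) (F : set_system R[i]) : ProperFilter F ->
    (forall e : R, 0 < e -> exists x, F [set y : R[i] | complex.Re `|x - y| < e]) ->
    exists l, forall e : R, 0 < e -> F [set y : R[i] | complex.Re `|l - y| < e].
Proof.
move=> FF Fc.
have normE (z : R[i]) : complex.Re `|z| = Num.sqrt (complex.Re z ^+ 2 + complex.Im z ^+ 2).
  by case: z => a b.
have coord (p : R[i] -> R) : (forall x y, p (x - y) = p x - p y) ->
    (forall z, `|p z| <= complex.Re `|z|) ->
    exists l, forall e : R, 0 < e -> F [set y : R[i] | `|l - p y| < e].
  move=> pB pn.
  have [|l Fl] := @real_complete R (p @ F) _.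
    move=> e /Fc [x Fx]; exists (p x); change (F [set z | `|p x - p z| < e]).
    by apply: filterS Fx => z /= ; rewrite -pB; exact: le_lt_trans.
  by exists l.
have [|z|a Fa] := coord (@complex.Re R); first by case=> ? ? [].
  rewrite normE -sqrtr_sqr ler_sqrt ?lerDl ?addr_ge0 ?sqr_ge0//.
have [|z|b Fb] := coord (@complex.Im R); first by case=> ? ? [].
  rewrite normE -sqrtr_sqr ler_sqrt ?lerDr ?addr_ge0 ?sqr_ge0//.
exists ((a +i* b)%C : R[i]) => e e0.
have e20 : 0 < e / 2 by rewrite divr_gt0.
apply: filterS (filterI (Fa _ e20) (Fb _ e20)) => -[c d] /= [ac bd].
have h (x y : R) : Num.sqrt (x ^+ 2 + y ^+ 2) <= `|x| + `|y|.
  rewrite -[leRHS]ger0_norm ?addr_ge0// -sqrtr_sqr.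
  rewrite ler_wsqrtr// sqrrD !real_normK ?num_real// lerD2r lerDl.
  by rewrite mulrn_wge0// mulr_ge0.
by rewrite (le_lt_trans (h _ _))// [ltRHS]splitr ltrD.
Qed.

Lemma complex_scalar_theory (R : realType) : scalar_theory (complex_scalars R).
Proof.
exists (real_complex R : {rmorphism R -> R[i]}) => /=.
- by move=> a b; rewrite lecR.
- by [].
- by move=> x; exact: (RRe_real (normr_real x)).
- by move=> x y; rewrite rmorphD.
- by move=> x y; rewrite rmorphM.
- by move=> x; rewrite sqr_normc.
- exact: conjcK.
- exact: conjc_real.
- by move=> F FF; exact: complex_complete.
Qed.

(** * Modulus and inner product of finite families of scalars *)

Section ScalarTheory.
Variables (R : realType) (K : scalars R) (A : scalar_theory K).
Implicit Types (x y : K) (a b : R).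

Definition abs x : R := reS `|x|.

Let inRabs x : inR A (abs x) = `|x|. Proof. exact: inR_norm. Qed.

Lemma inR_inj : injective (inR A).
Proof. exact: can_inj (reS_inR A). Qed.

Lemma inR_ge0 a : (0 <= inR A a) = (0 <= a).
Proof. by rewrite -(rmorph0 (inR A)) le_inR. Qed.

Lemma abs_ge0 x : 0 <= abs x.
Proof. by rewrite -inR_ge0 inRabs. Qed.

Lemma absM x y : abs (x * y) = abs x * abs y.
Proof. by apply: inR_inj; rewrite rmorphM !inRabs normrM. Qed.

Lemma abs1 : abs 1 = 1.
Proof. by apply: inR_inj; rewrite inRabs rmorph1 normr1. Qed.

Lemma abs_eq0 x : (abs x == 0) = (x == 0).
Proof. by rewrite -(inj_eq inR_inj) inRabs rmorph0 normr_eq0. Qed.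

Lemma abs0 : abs 0 = 0.
Proof. by apply/eqP; rewrite abs_eq0. Qed.

Lemma absV x : abs x^-1 = (abs x)^-1.
Proof. by apply: inR_inj; rewrite fmorphV !inRabs normfV. Qed.

Lemma absD x y : abs (x + y) <= abs x + abs y.
Proof. by rewrite -(le_inR A) rmorphD !inRabs ler_normD. Qed.

Lemma abs_inR a : abs (inR A a) = `|a|.
Proof.
apply: inR_inj; rewrite inRabs.
have [a0|/ltW a0] := leP 0 a.
  by rewrite !ger0_norm// inR_ge0.
rewrite (ler0_norm a0) ler0_norm ?rmorphN//.
by rewrite -(rmorph0 (inR A)) le_inR.
Qed.

Lemma norm_eq1 x : `|x| = 1 <-> abs x = 1.
Proof.
rewrite -inRabs; split=> [|->]; last by rewrite rmorph1.
by rewrite -(rmorph1 (inR A)) => /inR_inj.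
Qed.

Lemma conjS0 : conjS (0 : K) = 0.
Proof. by rewrite -(rmorph0 (inR A)) conjS_inR. Qed.

Lemma conjSN x : conjS (- x) = - conjS x.
Proof. by apply/eqP; rewrite -subr_eq0 opprK -(conjSD A) addNr conjS0. Qed.

Lemma conjSB x y : conjS (x - y) = conjS x - conjS y.
Proof. by rewrite (conjSD A) conjSN. Qed.

Lemma conjS_sum (I : Type) (r : seq I) (P : pred I) (F : I -> K) :
  conjS (\sum_(i <- r | P i) F i) = \sum_(i <- r | P i) conjS (F i).
Proof. exact: (big_morph _ (conjSD A) conjS0). Qed.

Lemma mulconjE x : x * conjS x = inR A (abs x ^+ 2).
Proof. by rewrite (mulconjS A) rmorphXn inRabs. Qed.

Lemma abs_conj x : abs (conjS x) = abs x.
Proof.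
apply/eqP; rewrite -(eqrXn2 (n := 2)) ?abs_ge0//; apply/eqP/inR_inj.
by rewrite -!mulconjE (conjSK A) mulrC.
Qed.

Section FiniteSums.
Variable W : finType.
Implicit Types u v : W -> K.

Definition ip u v : K := \sum_w u w * conjS (v w).
Definition nrm2 u : R := \sum_w abs (u w) ^+ 2.

Lemma nrm2_ge0 u : 0 <= nrm2 u.
Proof. by apply: sumr_ge0 => w _; rewrite sqr_ge0. Qed.

Lemma ipuu u : ip u u = inR A (nrm2 u).
Proof. by rewrite rmorph_sum; apply: eq_bigr => w _; rewrite mulconjE. Qed.

Lemma ipC u v : conjS (ip u v) = ip v u.
Proof.
rewrite conjS_sum; apply: eq_bigr => w _.
by rewrite (conjSM A) (conjSK A) mulrC.
Qed.

Lemma nrm2_eq0 u : nrm2 u = 0 -> forall w, u w = 0.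
Proof.
move/eqP; rewrite psumr_eq0 => [/allP h w|w _]; last exact: sqr_ge0.
by apply/eqP; have := h w (mem_index_enum w); rewrite sqrf_eq0 abs_eq0.
Qed.

(** The vector [<v,v> u - <u,v> v] is a multiple of the component of [u]
orthogonal to [v]; its norm measures the defect in the Cauchy-Schwarz
inequality. *)
Lemma nrm2_reject u v : nrm2 (fun w => inR A (nrm2 v) * u w - ip u v * v w)
  = nrm2 v * (nrm2 v * nrm2 u - abs (ip u v) ^+ 2).
Proof.
apply: inR_inj; rewrite -ipuu.
set p := nrm2 v; set c := ip u v.
transitivity (\sum_w ((inR A p * inR A p) * (u w * conjS (u w))
   - (inR A p * conjS c) * (u w * conjS (v w))
   - (inR A p * c) * (v w * conjS (u w)) + (c * conjS c) * (v w * conjS (v w)))).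
  apply: eq_bigr => w _; rewrite conjSB !(conjSM A) conjS_inR; ring.
rewrite !big_split /= !sumrN -!mulr_sumr.
have -> : \sum_i u i * conjS (u i) = inR A (nrm2 u) by rewrite -ipuu.
have -> : \sum_i v i * conjS (v i) = inR A p by rewrite -ipuu.
have -> : \sum_i u i * conjS (v i) = c by [].
have -> : \sum_i v i * conjS (u i) = conjS c by rewrite ipC.
by rewrite rmorphM rmorphB rmorphM -mulconjE; ring.
Qed.

Lemma cauchy_schwarz u v : abs (ip u v) ^+ 2 <= nrm2 u * nrm2 v.
Proof.
have := nrm2_ge0 (fun w => inR A (nrm2 v) * u w - ip u v * v w).
rewrite nrm2_reject; have := nrm2_ge0 v; rewrite le_eqVlt => /predU1P[v0 _|v0].
  rewrite -v0 mulr0; suff -> : ip u v = 0 by rewrite abs0 expr0n.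
  by apply: big1 => w _; rewrite (nrm2_eq0 (esym v0)) conjS0 mulr0.
by rewrite pmulr_rge0// subr_ge0 [X in _ <= X]mulrC.
Qed.

(** In the case of equality [<v,v> u - <u,v> v] vanishes by [nrm2_reject], so
that [u] and [v] are proportional. *)
Lemma cauchy_schwarz_eq u v : abs (ip u v) ^+ 2 = nrm2 u * nrm2 v ->
  forall w w', u w * v w' = u w' * v w.
Proof.
move=> e w w'; have := nrm2_reject u v; rewrite e mulrC [X in X - _]mulrC subrr mul0r.
move=> /nrm2_eq0 h.
have [v0|v0] := eqVneq (nrm2 v) 0.
  by rewrite !(nrm2_eq0 v0) !mulr0.
have p0 : inR A (nrm2 v) != 0 by rewrite fmorph_eq0.
apply: (mulfI p0).
by rewrite !mulrA (subr0_eq (h w)) (subr0_eq (h w')); ring.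
Qed.

End FiniteSums.
End ScalarTheory.

(** * Finite-dimensional Hilbert spaces *)

Section EllTwo.
Variables (R : realType) (K : scalars R) (A : scalar_theory K).

Section Norm.
Variable W : finType.
Implicit Types u v : W -> K.

Lemma nrm2Z (c : K) u : nrm2 (fun w => c * u w) = abs c ^+ 2 * nrm2 u.
Proof. by rewrite mulr_sumr; apply: eq_bigr => w _; rewrite (absM A) exprMn. Qed.

Lemma nrm2D u v :
  Num.sqrt (nrm2 (fun w => u w + v w)) <= Num.sqrt (nrm2 u) + Num.sqrt (nrm2 v).
Proof.
rewrite -[leRHS]ger0_norm ?addr_ge0 ?sqrtr_ge0// -sqrtr_sqr ler_wsqrtr//.
rewrite sqrrD !sqr_sqrtr ?nrm2_ge0//.
have -> : nrm2 (fun w => u w + v w) =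
    abs (ip u u + (ip u v + ip v u) + ip v v).
  rewrite -[LHS]ger0_norm ?nrm2_ge0// -(abs_inR A) -(ipuu A).
  congr abs; rewrite -!big_split; apply: eq_bigr => w _ /=.
  by rewrite (conjSD A); ring.
have ipE (x : W -> K) : abs (ip x x) = nrm2 x.
  by rewrite (ipuu A) (abs_inR A) ger0_norm ?nrm2_ge0.
apply: (le_trans (absD A _ _)); rewrite ipE lerD2r.
apply: (le_trans (absD A _ _)); rewrite ipE lerD2l.
apply: (le_trans (absD A _ _)); rewrite -[ip v u](ipC A) (abs_conj A) -mulr2n.
rewrite lerMn2r -sqrtrM ?nrm2_ge0//.
by rewrite -[leLHS]ger0_norm ?(abs_ge0 A)// -sqrtr_sqr ler_wsqrtr// cauchy_schwarz.
Qed.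

Lemma abs_le_nrm2 u w : abs (u w) <= Num.sqrt (nrm2 u).
Proof.
rewrite -[leLHS]ger0_norm ?(abs_ge0 A)// -sqrtr_sqr ler_wsqrtr//.
by rewrite /nrm2 (bigD1 w)//= lerDl sumr_ge0// => *; rewrite sqr_ge0.
Qed.

End Norm.

(** The argument [A] is only a label: the norm put on this type depends on it
through [inR]. *)
Definition l2 (A : scalar_theory K) (W : finType) : Type := {ffun W -> K^o}.

HB.instance Definition _ (W : finType) := GRing.Lmodule.on (l2 A W).

Variable W : finType.
Notation H := (l2 A W).

Definition l2_norm (u : H) : K := inR A (Num.sqrt (nrm2 (u : W -> K))).

Lemma l2_normD (x y : H) : l2_norm (x + y) <= l2_norm x + l2_norm y.
Proof.
rewrite -rmorphD le_inR.
have -> : nrm2 (x + y : W -> K) = nrm2 (fun w => x w + y w : K).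
  by apply: eq_bigr => w _; rewrite ffunE.
exact: nrm2D.
Qed.

Lemma l2_normZ (c : K) (x : H) : l2_norm (c *: x) = `|c| * l2_norm x.
Proof.
rewrite -(inR_norm A) -rmorphM; congr (inR A _).
have -> : nrm2 (c *: x : W -> K) = nrm2 (fun w => c * (x w : K)).
  by apply: eq_bigr => w _; rewrite ffunE.
by rewrite nrm2Z sqrtrM ?sqr_ge0// sqrtr_sqr ger0_norm ?(abs_ge0 A).
Qed.

Lemma l2_norm0_eq0 (x : H) : l2_norm x = 0 -> x = 0.
Proof.
move/eqP; rewrite fmorph_eq0 sqrtr_eq0 => x0; apply/ffunP => w; rewrite ffunE.
by apply: (nrm2_eq0 A (u := x)); apply/eqP; rewrite eq_le x0 nrm2_ge0.
Qed.

HB.instance Definition _ :=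
  Lmodule_isNormed.Build K H l2_normD l2_normZ l2_norm0_eq0.

Lemma l2_normE (u : H) : `|u| = inR A (Num.sqrt (nrm2 (u : W -> K))).
Proof. by []. Qed.

(** Each coordinate is 1-Lipschitz, so it converges along the filter; the
convergence is then uniform because there are finitely many coordinates. *)
Lemma l2_complete (F : set_system H) : ProperFilter F -> cauchy F -> cvg F.
Proof.
move=> FF /cauchyP Fc.
have coord w : exists l, forall e : R, 0 < e ->
    F [set u : H | reS `|(l : K) - u w| < e].
  have [|l Fl] := @scalar_complete _ _ A ((fun u : H => (u w : K)) @ F) _.
    move=> e e0; have /Fc[x Fx] : 0 < inR A e.
      by rewrite -(rmorph0 (inR A)) (leW_mono (le_inR A)).
    exists (x w); change (F [set u : H | reS `|(x w : K) - u w| < e]).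
    apply: filterS Fx => u; rewrite -ball_normE /= l2_normE.
    rewrite (leW_mono (le_inR A)); apply: le_lt_trans.
    by have := abs_le_nrm2 (x - u : W -> K) w; rewrite !ffunE.
  by exists l.
have /choice [l Fl] := coord.
apply/cvg_ex; exists ([ffun w => l w] : H); apply/cvgrPdist_lt => e e0.
have eE : e = inR A (abs e) by rewrite /abs (inR_norm A) ger0_norm ?ltW.
have a0 : 0 < abs e.
  by rewrite lt_def (abs_ge0 A) (abs_eq0 A) andbT gt_eqF.
(* A coordinatewise error of e / N suffices: the squares sum to less than e^2. *)
pose N : R := (#|W|.+1)%:R.
have N0 : 0 < N by rewrite ltr0n.
have d0 : 0 < abs e / N by rewrite divr_gt0.
have : F [set u : H | forall w, reS `|(l w : K) - u w| < abs e / N].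
  by apply: filter_forall => w; exact: Fl.
apply: filterS => u /= hu.
rewrite l2_normE eE (leW_mono (le_inR A)).
rewrite -[ltRHS]ger0_norm ?(abs_ge0 A)// -sqrtr_sqr ltr_sqrt ?exprn_gt0//.
have -> : nrm2 ([ffun w => l w] - u : W -> K) = nrm2 (fun w => (l w : K) - u w).
  by apply: eq_bigr => w _; rewrite !ffunE.
apply: (@le_lt_trans _ _ (\sum_(w : W) (abs e / N) ^+ 2)).
  apply: ler_sum => w _; rewrite lerXn2r ?nnegrE ?(abs_ge0 A) ?(ltW d0)//.
  by rewrite ltW// hu.
rewrite sumr_const -[X in X < _]mulr_natr exprMn exprVn -mulrA gtr_pMr ?exprn_gt0//.
rewrite mulrC ltr_pdivrMr ?exprn_gt0// mul1r expr2 -natrM ltr_nat.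
by rewrite mulnS ltn_addr.
Qed.

HB.instance Definition _ := Uniform_isComplete.Build H l2_complete.

Definition l2_dot (u v : H) : K := ip (u : W -> K) v.

Lemma l2_dotBl (v : H) : zmod_morphism (l2_dot^~ v).
Proof.
by move=> x y; rewrite /l2_dot /ip -sumrB; apply: eq_bigr => w _; rewrite !ffunE mulrBl.
Qed.

Lemma l2_dotC (x y : H) : l2_dot x y = conjS (l2_dot y x).
Proof. by rewrite /l2_dot (ipC A). Qed.

Lemma l2_dotBr (v : H) : zmod_morphism (l2_dot v).
Proof. by move=> x y; rewrite !(l2_dotC v) l2_dotBl (conjSB A). Qed.

Lemma l2_dotZl (v : H) : scalable_for *%R (l2_dot^~ v).
Proof.
by move=> c x; rewrite /l2_dot /ip mulr_sumr; apply: eq_bigr => w _; rewrite !ffunE mulrA.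
Qed.

Lemma l2_dotZr (v : H) : scalable_for (@conjS R K \; *%R) (l2_dot v).
Proof. by move=> c x; rewrite /= !(l2_dotC v) l2_dotZl (conjSM A). Qed.

HB.instance Definition _ := @isBilinear.Build K H H K *%R (@conjS R K \; *%R)
  l2_dot l2_dotBl l2_dotBr l2_dotZl l2_dotZr.

Lemma l2_dot_herm (x y : H) : l2_dot x y = (-1) ^+ false * conjS (l2_dot y x).
Proof. by rewrite expr0 mul1r l2_dotC. Qed.

HB.instance Definition _ := @isHermitianSesquilinear.Build K H false (@conjS R K)
  l2_dot l2_dot_herm.

Lemma l2_dot_norm (x : H) : `|x| ^+ 2 = l2_dot x x.
Proof. by rewrite l2_normE -rmorphXn sqr_sqrtr ?nrm2_ge0// /l2_dot (ipuu A). Qed.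

Lemma l2_dot_gt0 (x : H) : x != 0 -> 0 < l2_dot x x.
Proof. by move=> x0; rewrite -l2_dot_norm exprn_gt0// normr_gt0. Qed.

HB.instance Definition _ := @isDotProduct.Build K H l2_dot l2_dot_gt0.

Definition l2_hilbert : hilbert K := @Hilbert R K H l2_dot l2_dot_norm.

End EllTwo.

(** * Contractions, creation and annihilation of letters *)

Section LowerBound.
Variables (R : realType) (K : scalars R) (A : scalar_theory K).

Section Operators.
Variable W : finType.
Notation H := (l2 A W).
Implicit Types u : H.

(** Contractivity for the squared norm, which avoids square roots. *)
Definition contractive (X : H -> H) : Prop :=
  forall u, nrm2 (X u : W -> K) <= nrm2 (u : W -> K).

(** A partial isometry when [phi] is injective on [P]; both creation and
annihilation operators are of this form. *)
Definition pullback (P : pred W) (phi : W -> W) u : H :=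
  [ffun w => if P w then u (phi w) else 0].

Lemma pullback_linear (P : pred W) (phi : W -> W) : linear (pullback P phi).
Proof.
move=> c u v; apply/ffunP => w; rewrite !ffunE; case: ifP => // _.
by rewrite scaler0 addr0.
Qed.

HB.instance Definition _ (P : pred W) (phi : W -> W) :=
  GRing.isLinear.Build K H H *:%R (pullback P phi) (pullback_linear P phi).

Lemma pullback_contractive (P : pred W) (phi : W -> W) :
  {in P &, injective phi} -> contractive (pullback P phi).
Proof.
move=> phi_inj u; rewrite /nrm2.
rewrite (bigID P) /= [X in _ + X]big1 ?addr0; last first.
  by move=> w /negbTE Pw; rewrite ffunE Pw (abs0 A) expr0n.
rewrite (eq_bigr (fun w => abs (u (phi w) : K) ^+ 2)); last first.
  by move=> w Pw; rewrite ffunE Pw.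
rewrite -(big_imset (fun w => abs (u w : K) ^+ 2)) /=; last first.
  by move=> x y; exact: phi_inj.
rewrite [leRHS](bigID (mem (phi @: P)))/= lerDl.
by apply: sumr_ge0 => w _; rewrite sqr_ge0.
Qed.

Definition kernel_op (M : W -> W -> K) u : H :=
  [ffun w => \sum_w' M w w' * u w'].

Lemma kernel_op_linear (M : W -> W -> K) : linear (kernel_op M).
Proof.
move=> c u v; apply/ffunP => w; rewrite !ffunE scaler_sumr -big_split.
by apply: eq_bigr => w' _; rewrite !ffunE mulrDr /= mulrCA.
Qed.

HB.instance Definition _ (M : W -> W -> K) :=
  GRing.isLinear.Build K H H *:%R (kernel_op M) (kernel_op_linear M).

Definition delta (w0 : W) : H := [ffun w => (w == w0)%:R].

Lemma nrm2_delta w0 : nrm2 (delta w0 : W -> K) = 1.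
Proof.
rewrite /nrm2 (bigD1 w0)//= ffunE eqxx (abs1 A) expr1n big1 ?addr0// => w /negbTE ww.
by rewrite ffunE ww (abs0 A) expr0n.
Qed.

Lemma op_norm_contractive (X : {linear H -> H}) : contractive X ->
  (op_norm (X : l2_hilbert A W -> l2_hilbert A W) <= 1)%E.
Proof.
move=> Xc; apply: ge_ereal_sup => _ [u /= u1 <-]; rewrite lee_fin.
rewrite l2_normE (reS_inR A); apply: (@le_trans _ _ (Num.sqrt (nrm2 (u : W -> K)))).
  by rewrite ler_wsqrtr.
by move: u1; rewrite l2_normE -(rmorph1 (inR A)) le_inR.
Qed.

End Operators.

Variables (d n : nat) (T : {ffun 'I_d -> 'rV[K]_n} -> K).

(** A coordinate of the image of a unit vector is at most the operator norm, and
the space of square-summable families on [W] is one of the Hilbert spaces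
which the supremum ranges over. *)
Lemma coef_pairing_le_cb (W : finType) (X : 'I_d -> 'I_n -> {linear l2 A W -> l2 A W})
    (v : l2 A W) (w : W) :
  (forall s j, contractive (X s j)) -> nrm2 (v : W -> K) <= 1 ->
  ((abs (\sum_(i : {ffun 'I_d -> 'I_n}) coef T i *
     (\big[(fun f g : l2 A W -> l2 A W => f \o g)/idfun]_(s < d)
                   (X s (i s) : l2 A W -> l2 A W)) v w))%:E <= cb_norm T)%E.
Proof.
move=> Xc v1.
pose x : \bar R := op_norm (eval_ops T (H := l2_hilbert A W) X).
have xcb : (x <= cb_norm T)%E.
  apply: ereal_sup_ubound; exists (l2_hilbert A W), X; split => // s j.
  exact: op_norm_contractive.
apply: le_trans xcb; pose y := eval_ops T (H := l2_hilbert A W) X v.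
apply: (@le_trans _ _ (reS `|y|)%:E); last first.
  apply: ereal_sup_ubound; exists v => //=; rewrite l2_normE -(rmorph1 (inR A)) le_inR.
  by rewrite -(sqrtr1 R) ler_wsqrtr.
rewrite lee_fin l2_normE (reS_inR A).
apply: le_trans (abs_le_nrm2 A _ w); rewrite /y /eval_ops sum_ffunE.
by under [in leRHS]eq_bigr do rewrite ffunE.
Qed.

(** An invariant of the successive states obtained by applying the composite from
right to left: [P t] describes the state once the slots from [t] on have
acted. *)
Lemma big_comp_ind (U : Type) (P : nat -> U -> Prop) (m : nat) (F : 'I_m -> U -> U) (v : U) :
  P m v -> (forall (s : 'I_m) u, P s.+1 u -> P s (F s u)) ->
  P 0%N ((\big[(fun f g : U -> U => f \o g)/idfun]_(s < m) F s) v).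
Proof.
elim: m P F => [|m IHm] P F Pv Pstep; first by rewrite big_ord0.
rewrite big_ord_recl; apply: (Pstep ord0).
by apply: (IHm (fun t => P t.+1)) => // s u; exact: (Pstep (lift ord0 s)).
Qed.

(** Partial words: slot [s] holds a letter or is still empty. *)
Definition pword := {ffun 'I_d -> option 'I_n}.
Implicit Types (f : pword) (i : {ffun 'I_d -> 'I_n}).

Definition set_letter f (s : 'I_d) o : pword := [ffun t => if t == s then o else f t].
Definition below i (t : nat) : pword := [ffun s : 'I_d => if (s < t)%N then Some (i s) else None].
Definition above i (t : nat) : pword := [ffun s : 'I_d => if (t <= s)%N then Some (i s) else None].

Definition creation (s : 'I_d) (j : 'I_n) : {linear l2 A pword -> l2 A pword} :=
  pullback (fun f => f s == Some j) (fun f => set_letter f s None).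
Definition annihilation (s : 'I_d) (j : 'I_n) : {linear l2 A pword -> l2 A pword} :=
  pullback (fun f => f s == None) (fun f => set_letter f s (Some j)).

Lemma creation_contractive s j : contractive (creation s j).
Proof.
apply: pullback_contractive => f g; rewrite !unfold_in => /eqP fs /eqP gs /ffunP e.
apply/ffunP => t; have := e t; rewrite !ffunE.
by have [->|//] := eqVneq; rewrite fs gs.
Qed.

Lemma annihilation_contractive s j : contractive (annihilation s j).
Proof.
apply: pullback_contractive => f g; rewrite !unfold_in => /eqP fs /eqP gs /ffunP e.
apply/ffunP => t; have := e t; rewrite !ffunE.
by have [->|//] := eqVneq; rewrite fs gs.
Qed.

Lemma ltn_ord_neq (s t : 'I_d) : t != s -> (s < t)%N = (s <= t)%N.
Proof. by rewrite eq_sym -val_eqE /= ltn_neqAle => ->. Qed.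

Lemma creation_above i (s : 'I_d) :
  creation s (i s) (delta (above i s.+1)) = delta (above i s).
Proof.
apply/ffunP => f; rewrite !ffunE; have [fs|fs] := eqVneq (f s) (Some (i s)).
  congr ((_ : bool)%:R); apply/eqP/eqP => /ffunP e; apply/ffunP => t; have := e t; rewrite !ffunE.
    have [->|ts ->] := eqVneq; first by rewrite leqnn fs.
    by rewrite ltn_ord_neq.
  have [-> _|ts ->] := eqVneq; first by rewrite ltnn.
  by rewrite ltn_ord_neq.
have [e|//] := eqVneq f (above i s).
by move: fs; rewrite e ffunE leqnn eqxx.
Qed.

Lemma annihilation_below i (s : 'I_d) u :
  annihilation s (i s) u (below i s) = u (below i s.+1).
Proof.
rewrite ffunE ffunE ltnn eqxx; congr (u _); apply/ffunP => t; rewrite !ffunE.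
have [->|ts] := eqVneq; first by rewrite ltnS leqnn.
by rewrite ltnS ltn_ord_neq// eq_sym.
Qed.

(** The slots from [b] on create letters, those before [a] annihilate them, and
those in between act by arbitrary contractions [Y].  The states [E i t] are
prescribed down to slot [a]; annihilation then only reads the coordinate at
the first [a] letters of [i]. *)
Lemma word_pairing_le_cb (a b : nat) (Y : 'I_d -> 'I_n -> {linear l2 A pword -> l2 A pword})
    (E : {ffun 'I_d -> 'I_n} -> nat -> l2 A pword) :
  (forall s j, contractive (Y s j)) ->
  (forall i t, (b <= t)%N -> E i t = delta (above i t)) ->
  (forall i (s : 'I_d), (a <= s < b)%N -> E i s = Y s (i s) (E i s.+1)) ->
  (a <= b <= d)%N ->
  ((abs (\sum_i coef T i * E i a (below i a)))%:E <= cb_norm T)%E.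
Proof.
move=> Yc Eb Es /andP[ab bd].
pose X (s : 'I_d) (j : 'I_n) :=
  if (s < a)%N then annihilation s j else if (s < b)%N then Y s j else creation s j.
have Xc s j : contractive (X s j).
  rewrite /X; case: ifP => _; first exact: annihilation_contractive.
  by case: ifP => _; [exact: Yc | exact: creation_contractive].
pose o : pword := [ffun => None].
have := coef_pairing_le_cb (v := delta o) o Xc.
rewrite nrm2_delta => /(_ (lexx _)); congr (_%:E <= _)%E; congr abs.
apply: eq_bigr => i _; congr (_ * _).
(* Before slot a the state is known only at the coordinate that will be read. *)
pose P t (u : l2 A pword) := ((a <= t)%N -> u = E i t) /\
  ((t <= a)%N -> u (below i t) = E i a (below i a)).
have oE t : (d <= t)%N -> o = above i t.
  by move=> dt; apply/ffunP => s; rewrite !ffunE leqNgt (leq_trans (ltn_ord s) dt).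
rewrite {1}(oE d)//.
have -> : o = below i 0 by apply/ffunP => s; rewrite !ffunE.
have [] // : P 0%N ((\big[(fun f g : l2 A pword -> l2 A pword => f \o g)/idfun]_(s < d)
                   (X s (i s) : l2 A pword -> l2 A pword)) (delta (above i d))).
apply: big_comp_ind => [|s u [uE uB]].
  split=> [_|da]; first by rewrite Eb.
  have -> : a = d by apply/eqP; rewrite eqn_leq da (leq_trans ab bd).
  by rewrite Eb.
have first_part : (a <= s)%N -> X s (i s) u = E i s.
  move=> le_as; rewrite /X ltnNge le_as /= uE ?(leq_trans le_as)//.
  case: ltnP => [sb|bs]; first by rewrite Es ?le_as.
  by rewrite !Eb ?(leq_trans bs)// creation_above.
split=> //; rewrite leq_eqVlt => /predU1P[sa|sa].
  by rewrite first_part -sa.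
by rewrite /X sa annihilation_below uB.
by move=> _; apply.
Qed.
End LowerBound.

(** * Hilbert-Schmidt bounds and rank one *)

Section Kernels.
Variables (R : realType) (K : scalars R) (A : scalar_theory K) (W : finType).
Implicit Types (M : W -> W -> K) (u : l2 A W).

(** The squared Hilbert-Schmidt norm. *)
Definition hs2 M : R := \sum_r nrm2 (M^~ r).
(** The squared Hilbert-Schmidt norm of [M^* M]. *)
Definition gram2 M : R := nrm2 (fun p : W * W => ip (M^~ p.1) (M^~ p.2)).

(** [|M u|^2] is the pairing of the Gram matrix of the columns of [M] with the
matrix [u^* u]; the Cauchy-Schwarz inequality applies. *)
Lemma nrm2_kernel_op M u :
  nrm2 (kernel_op M u : W -> K) ^+ 2 <= gram2 M * nrm2 (u : W -> K) ^+ 2.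
Proof.
pose uu (p : W * W) : K := conjS (u p.1 : K) * u p.2.
have -> : nrm2 (u : W -> K) ^+ 2 = nrm2 uu.
  rewrite expr2 {1}/nrm2 mulr_suml [RHS](eq_bigr (fun p =>
     abs (u p.1 : K) ^+ 2 * abs (u p.2 : K) ^+ 2)); last first.
    by move=> p _; rewrite (absM A) (abs_conj A) exprMn.
  rewrite -(pair_bigA _ (fun x y => abs (u x : K) ^+ 2 * abs (u y : K) ^+ 2)) /=.
  by apply: eq_bigr => x _; rewrite mulr_sumr.
apply: le_trans (cauchy_schwarz A _ _).
suff -> : nrm2 (kernel_op M u : W -> K) =
   abs (ip (fun p : W * W => ip (M^~ p.1) (M^~ p.2)) uu) by [].
rewrite -[LHS]ger0_norm ?nrm2_ge0// -(abs_inR A) -ipuu; congr abs.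
rewrite /ip -(pair_bigA _ (fun x y => (\sum_w M w x * conjS (M w y)) *
   conjS (conjS (u x : K) * u y))) /=.
under eq_bigr => w _.
  rewrite !ffunE (conjS_sum A) mulr_suml.
  under eq_bigr => x _.
    rewrite mulr_sumr.
    over.
  over.
rewrite exchange_big /=; apply: eq_bigr => x _.
rewrite exchange_big /=; apply: eq_bigr => y _.
rewrite mulr_suml; apply: eq_bigr => w _.
by rewrite !(conjSM A) (conjSK A); ring.
Qed.

Lemma gram2_le_hs2 M : gram2 M <= hs2 M ^+ 2.
Proof.
rewrite expr2 {1}/hs2 mulr_suml; under [leRHS]eq_bigr do rewrite mulr_sumr.
rewrite pair_bigA; apply: ler_sum => p _; exact: cauchy_schwarz.
Qed.

(** Equality forces the equality case of the Cauchy-Schwarz inequality for every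
pair of columns, that is, rank one. *)
Lemma gram2_eq_hs2 M : gram2 M = hs2 M ^+ 2 ->
  forall l l' r r', M l r * M l' r' = M l' r * M l r'.
Proof.
move=> e l l' r r'; apply: (cauchy_schwarz_eq A (u := M^~ r) (v := M^~ r')).
have : \sum_p (nrm2 (M^~ p.1) * nrm2 (M^~ p.2) -
    abs (ip (M^~ p.1) (M^~ p.2)) ^+ 2) == 0.
  rewrite sumrB -[X in _ - X]/(gram2 M) e subr_eq0; apply/eqP.
  rewrite expr2 {1}/hs2 mulr_suml; under [RHS]eq_bigr do rewrite mulr_sumr.
  by rewrite pair_bigA.
rewrite psumr_eq0 => [/allP h|p _]; last by rewrite subr_ge0 cauchy_schwarz.
by apply/esym/eqP; rewrite -subr_eq0; exact: (h (r, r') (mem_index_enum _)).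
Qed.

Lemma gram2_eq0 M : gram2 M = 0 -> hs2 M = 0.
Proof.
move/(nrm2_eq0 A) => h; apply: big1 => r _.
apply: (inR_inj (A := A)); rewrite -ipuu rmorph0; exact: (h (r, r)).
Qed.

End Kernels.

(** * The bound attached to one slot *)

Section SlotBound.
Variables (R : realType) (K : scalars R) (A : scalar_theory K).

Lemma gram2_conjZ (W : finType) (M : W -> W -> K) (c : R) :
  gram2 (fun l r => conjS (M l r) * inR A c) = c ^+ 4 * gram2 M.
Proof.
rewrite /gram2 /nrm2 mulr_sumr; apply: eq_bigr => p _.
have -> : ip (fun l => conjS (M l p.1) * inR A c) (fun l => conjS (M l p.2) * inR A c)
   = inR A (c ^+ 2) * conjS (ip (M^~ p.1) (M^~ p.2)).
  rewrite (conjS_sum A) mulr_sumr; apply: eq_bigr => l _.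
  by rewrite !(conjSM A) !(conjSK A) conjS_inR rmorphXn; ring.
rewrite (absM A) (abs_conj A) (abs_inR A) exprMn ger0_norm ?sqr_ge0//.
by rewrite -exprM.
Qed.

Variables (d n : nat).
Notation idx := {ffun 'I_d -> 'I_n}.
Implicit Types (i : {ffun 'I_d -> 'I_n}) (t : idx -> K).

(** The subtensor of [t] with letter [a] in slot [k], as a matrix from the
letters after [k] to the letters before [k].  By [slice_fiber] the sum has at
most one term; writing a sum gives the value zero to words of the wrong
shape. *)
Definition slice t (k : 'I_d) (a : 'I_n) (l r : pword d n) : K :=
  \sum_(i : idx | [&& i k == a, below i k == l & above i k.+1 == r]) t i.

Definition slot2 t (k : 'I_d) (a : 'I_n) : R := \sum_(i : idx | i k == a) abs (t i) ^+ 2.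

Lemma slice_inj (k : 'I_d) i i' :
  i k = i' k -> below i k = below i' k -> above i k.+1 = above i' k.+1 -> i = i'.
Proof.
move=> ik /ffunP b /ffunP a; apply/ffunP => s.
case: (ltngtP s k) => sk; last by rewrite (val_inj sk).
  by have := b s; rewrite !ffunE sk => -[].
by have := a s; rewrite !ffunE sk => -[].
Qed.

Lemma slice_fiber (V : nmodType) (x : idx -> V) (k : 'I_d) i :
  \sum_(i' : idx | [&& i' k == i k, below i' k == below i k & above i' k.+1 == above i k.+1]) x i'
  = x i.
Proof.
rewrite (big_pred1 i)// => i'; apply/and3P/eqP => [[/eqP ? /eqP ? /eqP ?]|->].
  exact: (@slice_inj k).
by rewrite !eqxx.
Qed.

Lemma sliceE t (k : 'I_d) i : slice t k (i k) (below i k) (above i k.+1) = t i.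
Proof. exact: slice_fiber. Qed.

Lemma hs2_slice t k a : hs2 (slice t k a) = slot2 t k a.
Proof.
rewrite /hs2 /nrm2 exchange_big /= pair_bigA /=.
rewrite /slot2 (partition_big (fun i : idx => (below i k, above i k.+1)) xpredT) //=.
apply: eq_bigr => -[l r] _ /=; rewrite /slice.
under [RHS]eq_bigl do rewrite xpair_eqE.
have [i|no] := pickP (fun i : idx => [&& i k == a, below i k == l & above i k.+1 == r]).
  by move=> /and3P[/eqP <- /eqP <- /eqP <-]; rewrite !slice_fiber.
by rewrite !big_pred0// (abs0 A) expr0n.
Qed.

(** The square root of the Hilbert-Schmidt norm of [A^* A], where [A] is the
slice: an upper bound for the operator norm of [A] by [nrm2_kernel_op]. *)
Definition slice_op_bound t k a : R := Num.sqrt (Num.sqrt (gram2 (slice t k a))).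

Variable T : {ffun 'I_d -> 'rV[K]_n} -> K.
Variable C : R.
Hypothesis cbC : (cb_norm T <= C%:E)%E.

(** Slot [k] acts by the conjugate of each slice, divided by
[slice_op_bound] so as to be a contraction; every coefficient is then paired
with its own conjugate. *)
Lemma slot_pairing_le k :
  \sum_(i : idx) abs (coef T i) ^+ 2 / slice_op_bound (coef T) k (i k) <= C.
Proof.
pose s a := slice_op_bound (coef T) k a.
pose B a : {linear l2 A (pword d n) -> l2 A (pword d n)} :=
  kernel_op (A := A) (fun l r => conjS (slice (coef T) k a l r) * inR A (s a)^-1).
have s_ge0 a : 0 <= s a by exact: sqrtr_ge0.
have Bc a : contractive (B a).
  move=> u; rewrite -[leLHS](@ger0_norm R) ?nrm2_ge0// -[leRHS](@ger0_norm R) ?nrm2_ge0//.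
  rewrite -ler_sqr ?nnegrE ?normr_ge0// !real_normK ?num_real//.
  apply: (le_trans (nrm2_kernel_op _ _)); rewrite gram2_conjZ.
  have s4 : s a ^+ 4 = gram2 (slice (coef T) k a).
    by rewrite (exprM _ 2 2) !sqr_sqrtr ?sqrtr_ge0// nrm2_ge0.
  rewrite -s4 exprVn; have [->|s0] := eqVneq (s a) 0.
    by rewrite expr0n /= mulr0 mul0r sqr_ge0.
  by rewrite mulVf ?mul1r// expf_neq0.
pose E i (m : nat) : l2 A (pword d n) :=
  if (k < m)%N then delta A (above i m) else B (i k) (delta A (above i k.+1)).
have : ((abs (\sum_(i : idx) coef T i * E i k (below i k)))%:E <= cb_norm T)%E.
  apply: (@word_pairing_le_cb _ _ A d n T k k.+1 (fun _ j => B j) E) => //.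
  - by move=> i m km; rewrite /E km.
  - move=> i s0 /andP[ks sk].
    have -> : s0 = k by apply/val_inj/eqP; rewrite eqn_leq -ltnS sk ks.
    by rewrite /E ltnn leqnn.
  - by rewrite leqnSn /=.
move=> /le_trans/(_ cbC); rewrite lee_fin; apply: le_trans.
rewrite -[leLHS]ger0_norm; last first.
  by apply: sumr_ge0 => i _; rewrite divr_ge0 ?sqr_ge0 ?s_ge0.
rewrite -(abs_inR A) le_eqVlt; apply/orP; left; apply/eqP; congr abs.
rewrite rmorph_sum; apply: eq_bigr => i _.
rewrite /E ltnn ffunE (bigD1 (above i k.+1))//= ffunE eqxx mulr1 big1 ?addr0; last first.
  by move=> r /negbTE rk; rewrite ffunE rk mulr0.
by rewrite sliceE mulrA (mulconjE A) rmorphM.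
Qed.

Lemma slot_pairing_le_sum k :
  \sum_a slot2 (coef T) k a / slice_op_bound (coef T) k a <= C.
Proof.
apply: le_trans (slot_pairing_le k); rewrite [leRHS](partition_big (fun i : idx => i k) xpredT)//=.
by apply: ler_sum => a _; rewrite mulr_suml; apply: ler_sum => i /eqP ->.
Qed.

Lemma slot2_ge0 t k a : 0 <= slot2 t k a.
Proof. by apply: sumr_ge0 => i _; rewrite sqr_ge0. Qed.

Lemma slice_op_bound_le t k a : slice_op_bound t k a <= Num.sqrt (slot2 t k a).
Proof.
rewrite ler_wsqrtr// -[leRHS](@ger0_norm R) ?slot2_ge0// -sqrtr_sqr ler_wsqrtr//.
by rewrite -hs2_slice; exact: gram2_le_hs2.
Qed.

(** The Hilbert-Schmidt norm dominates the bound of the operator norm, so the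
quotient can only increase when the former replaces the latter. *)
Lemma slot2_div_ge t k a :
  Num.sqrt (slot2 t k a) <= slot2 t k a / slice_op_bound t k a
   ?= iff (slice_op_bound t k a == Num.sqrt (slot2 t k a)).
Proof.
set p := Num.sqrt _; set b := slice_op_bound _ _ _.
have -> : slot2 t k a = p ^+ 2 by rewrite sqr_sqrtr ?slot2_ge0.
have bp : b <= p by exact: slice_op_bound_le.
have b0 : 0 <= b by exact: sqrtr_ge0.
have [e|bn0] := eqVneq b 0.
  have p0 : p = 0.
    apply/eqP; rewrite sqrtr_eq0 -hs2_slice (gram2_eq0 A (M := slice t k a))//.
    have g0 : Num.sqrt (gram2 (slice t k a)) == 0.
      by rewrite eq_le sqrtr_ge0 andbT -sqrtr_eq0; apply/eqP.
    by apply/eqP; rewrite eq_le nrm2_ge0 andbT -sqrtr_eq0.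
  by rewrite p0 e expr0n /= mul0r; split; rewrite ?eqxx.
have bgt0 : 0 < b by rewrite lt_def bn0.
split; first by rewrite ler_pdivlMr// expr2 ler_wpM2l// (le_trans b0).
have p0 : p != 0 by rewrite gt_eqF// (lt_le_trans bgt0).
rewrite eq_sym (can2_eq (divfK bn0) (mulfK bn0)) expr2 eq_sym.
by rewrite (inj_eq (mulfI p0)).
Qed.

Lemma sum_slot_le k : \sum_a Num.sqrt (slot2 (coef T) k a) <= C.
Proof.
apply: le_trans (slot_pairing_le_sum k).
by apply: ler_sum => a _; exact: slot2_div_ge.
Qed.

Lemma sum_slot_eq k : \sum_a Num.sqrt (slot2 (coef T) k a) = C ->
  forall a l l' r r', slice (coef T) k a l r * slice (coef T) k a l' r' =
    slice (coef T) k a l' r * slice (coef T) k a l r'.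
Proof.
move=> e a; apply: (gram2_eq_hs2 A).
have := slot_pairing_le_sum k; rewrite -e.
have := leif_sum (fun a (_ : xpredT a) => slot2_div_ge (coef T) k a).
move=> /[dup] /ge_leif -> _ /forallP /(_ a) /= /eqP.
rewrite hs2_slice => /(congr1 (fun x => x ^+ 2)).
rewrite !sqr_sqrtr ?sqrtr_ge0 ?slot2_ge0// => /(congr1 (fun x => x ^+ 2)).
by rewrite sqr_sqrtr ?nrm2_ge0.
Qed.

End SlotBound.

(** * The mixed-norm inequality and its case of equality *)

Section MixedNorms.
Variables (R : realType) (d n : nat).
Notation idx := {ffun 'I_d -> 'I_n}.
Variables (x : idx -> R) (C : R).
Hypothesis x_ge0 : forall i, 0 <= x i.
Hypothesis C_gt0 : 0 < C.

Definition slot_norm (k : 'I_d) (a : 'I_n) : R :=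
  Num.sqrt (\sum_(i : idx | i k == a) x i ^+ 2).

Hypothesis sum_slot_norm : forall k, \sum_a slot_norm k a <= C.

Let q : R := (2 * d)%:R / (d + 1)%:R.
Let z (i : idx) : R := (x i / C) `^ q.
Let g (o : 'I_d.+1) (i : idx) : R :=
  if unlift ord0 o is Some k then x i ^+ 2 / (slot_norm k (i k) * C)
  else \prod_k (slot_norm k (i k) / C).

Lemma slot_norm_ge0 k a : 0 <= slot_norm k a.
Proof. exact: sqrtr_ge0. Qed.

Lemma slot_norm_eq0 k (i : idx) : slot_norm k (i k) = 0 -> x i = 0.
Proof.
move/eqP; rewrite sqrtr_eq0 => s0.
have /eqP : \sum_(i' : idx | i' k == i k) x i' ^+ 2 = 0.
  by apply/eqP; rewrite eq_le s0 sumr_ge0// => *; rewrite sqr_ge0.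
rewrite psumr_eq0 => [/allP /(_ i (mem_index_enum _))|*]; last by rewrite sqr_ge0.
by rewrite eqxx sqrf_eq0 => /eqP.
Qed.

Let g_ge0 o i : 0 <= g o i.
Proof.
rewrite /g; case: unliftP => [k _|_].
  by rewrite divr_ge0 ?sqr_ge0// mulr_ge0 ?slot_norm_ge0 ?ltW.
by apply: prodr_ge0 => k _; rewrite divr_ge0 ?slot_norm_ge0 ?ltW.
Qed.

Let z_ge0 i : 0 <= z i. Proof. exact: powR_ge0. Qed.

Let prod_g i : \prod_o g o i = z i ^+ d.+1.
Proof.
have -> : z i ^+ d.+1 = (x i / C) ^+ (2 * d).
  rewrite -!powR_mulrn ?powR_ge0 ?divr_ge0 ?(ltW C_gt0)// -powRrM.
  congr powR; rewrite /q addn1 -mulrA mulVf ?mulr1// pnatr_eq0//.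
rewrite big_ord_recl /g unlift_none.
under [X in _ * X]eq_bigr do rewrite liftK.
rewrite -big_split /=.
have [x0|xn0] := eqVneq (x i) 0.
  rewrite x0 mul0r (eq_bigr (fun=> 0)) => [|k _]; last by rewrite expr0n /= mul0r mulr0.
  by rewrite prodr_const card_ord !expr0n muln_eq0.
rewrite (eq_bigr (fun=> (x i / C) ^+ 2)) ?prodr_const ?card_ord -?exprM// => k _.
have s0 : slot_norm k (i k) != 0 by apply: contra_neq xn0; exact: slot_norm_eq0.
by field; rewrite s0 gt_eqF.
Qed.

Let sum_g_None : \sum_i g ord0 i = \prod_k ((\sum_a slot_norm k a) / C).
Proof.
rewrite /g unlift_none -(bigA_distr_bigA (fun k a => slot_norm k a / C)).
by apply: eq_bigr => k _; rewrite mulr_suml.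
Qed.

Let sum_g_Some k : \sum_i g (lift ord0 k) i = (\sum_a slot_norm k a) / C.
Proof.
rewrite /g liftK (partition_big (fun i : idx => i k) xpredT)//= mulr_suml.
apply: eq_bigr => a _.
rewrite (eq_bigr (fun i : idx => x i ^+ 2 * (slot_norm k a * C)^-1)); last first.
  by move=> i /eqP ->.
rewrite -mulr_suml; set S := \sum_(i | _) _.
have -> : S = slot_norm k a ^+ 2.
  by rewrite sqr_sqrtr// sumr_ge0// => *; rewrite sqr_ge0.
have [->|s0] := eqVneq (slot_norm k a) 0; first by rewrite expr0n /= !mul0r.
by field; rewrite s0 gt_eqF.
Qed.

Let sum_g_le1 o : \sum_i g o i <= 1.
Proof.
have S1 k : 0 <= (\sum_a slot_norm k a) / C <= 1.
  rewrite ler_pdivrMr// mul1r sum_slot_norm andbT divr_ge0 ?(ltW C_gt0)//.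
  by apply: sumr_ge0 => a _; exact: slot_norm_ge0.
case: (unliftP ord0 o) => [k ->|->].
  by rewrite sum_g_Some; case/andP: (S1 k).
rewrite sum_g_None; apply: prodr_ile1 => k _; exact: S1.
Qed.

Let mean i : R := (\sum_o g o i) / d.+1%:R.

Let z_le_mean i : z i <= mean i ?= iff [forall o, forall o', g o i == g o' i].
Proof.
have [le eq] := @leif_AGM _ _ (mem 'I_d.+1) (fun o => g o i) (fun o _ => g_ge0 o i).
have mean0 : 0 <= mean i by rewrite divr_ge0// sumr_ge0.
have cE : #|mem 'I_d.+1| = d.+1 by rewrite cardT size_enum_ord.
move: le eq; rewrite cE (eq_bigl xpredT)// [in X in X / _](eq_bigl xpredT)// => le eq.
rewrite prod_g -/(mean i) in le eq.
split; first by move: le; rewrite ler_pXn2r// nnegrE.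
by rewrite -(eqrXn2 (n := d.+1)).
Qed.

Let sum_mean : \sum_i mean i = (\sum_o \sum_i g o i) / d.+1%:R.
Proof. by rewrite -mulr_suml exchange_big. Qed.

Let sum_mean_le1 : \sum_i mean i <= 1.
Proof.
rewrite sum_mean ler_pdivrMr ?ltr0n// mul1r.
apply: (@le_trans _ _ (\sum_(o < d.+1) 1)); first exact: ler_sum.
by rewrite sumr_const card_ord.
Qed.

Let sum_zE : \sum_i x i `^ q = (\sum_i z i) * C `^ q.
Proof.
rewrite mulr_suml; apply: eq_bigr => i _.
by rewrite -powRM ?divr_ge0 ?(ltW C_gt0)// divfK// gt_eqF.
Qed.

(** Hoelder's inequality for [d + 1] factors.  The weights are
[x i ^ 2 / (slot_norm k (i k) * C)], one for each slot [k], and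
[prod_k slot_norm k (i k) / C].  Their sums over [i] are at most one and their
geometric mean is [(x i / C) ^ q]. *)
Lemma blei_le : \sum_i x i `^ q <= C `^ q.
Proof.
rewrite sum_zE ler_piMl ?powR_ge0//; apply: le_trans sum_mean_le1.
by apply: ler_sum => i _; exact: z_le_mean.
Qed.

Lemma blei_eq : \sum_i x i `^ q = C `^ q ->
  (forall k, \sum_a slot_norm k a = C) /\
  (forall i k, x i ^+ 2 / (slot_norm k (i k) * C) = \prod_j (slot_norm j (i j) / C)).
Proof.
have Cq : C `^ q != 0 by rewrite gt_eqF// powR_gt0.
rewrite sum_zE -[RHS]mul1r => /(mulIf Cq) z1.
have := leif_sum (fun i (_ : xpredT i) => z_le_mean i); rewrite z1 => h.
have m1 : \sum_i mean i = 1 by apply/eqP; rewrite eq_le sum_mean_le1 h.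
have all_eq i o o' : g o i = g o' i.
  move: (ge_leif h); rewrite m1 lexx => /esym/forallP/(_ i)/=/forallP/(_ o)/forallP/(_ o').
  by move/eqP.
have gsum o : \sum_i g o i = 1.
  have : \sum_o (1 - \sum_i g o i) == 0.
    rewrite sumrB sumr_const card_ord subr_eq0 eq_sym; apply/eqP.
    by move: m1; rewrite sum_mean => /(canRL (divfK _)); rewrite mul1r; apply; rewrite pnatr_eq0.
  rewrite psumr_eq0 => [/allP/(_ o (mem_index_enum _))|o' _]; last by rewrite subr_ge0.
  by rewrite subr_eq0 => /eqP.
split=> [k|i k].
  have := sum_g_Some k; rewrite gsum => /(congr1 (fun y => y * C)).
  by rewrite mul1r divfK ?gt_eqF// => <-.
have := all_eq i (lift ord0 k) ord0.
by rewrite /g liftK unlift_none.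
Qed.

End MixedNorms.

Section Structure.
Variables (R : realType) (d n : nat).
Notation idx := {ffun 'I_d -> 'I_n}.

Definition update (i : idx) (s : 'I_d) (y : 'I_n) : idx :=
  [ffun s' => if s' == s then y else i s'].

(** By [blei_eq] the number [slot_norm k (i k)] does not depend on [k] for [i] in
the support, and changing one letter at a time shows that it does not depend
on [i] either.  The sets [J k] are the supports of these marginals; their
cardinals agree because the marginal sums are all equal to [C]. *)
Lemma blei_eq_structure (x : idx -> R) (C : R) : (2 <= d)%N ->
  (forall i, 0 <= x i) -> 0 < C ->
  (forall k, \sum_a slot_norm x k a <= C) ->
  (exists i, x i != 0) ->
  \sum_i x i `^ ((2 * d)%:R / (d + 1)%:R) = C `^ ((2 * d)%:R / (d + 1)%:R) ->
  exists (m : nat) (J : 'I_d -> {set 'I_n}) (c : R),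
  [/\ (0 < m)%N, (forall k, #|J k| = m), 0 < c,
      C ^+ 2 = c ^+ 2 * m%:R ^+ d.+1 &
      forall i, x i = if [forall s, i s \in J s] then c else 0].
Proof.
move=> d2 x_ge0 C_gt0 xC [i0 xi0] /(blei_eq x_ge0 C_gt0 xC) [sumC eqs].
have Cn0 : C != 0 by rewrite gt_eqF.
pose J k : {set 'I_n} := [set a | slot_norm x k a != 0]%SET.
have J0 (i : idx) : ~~ [forall s, i s \in J s] -> x i = 0.
  move=> /forallPn[s]; rewrite inE negbK => /eqP; exact: slot_norm_eq0.
have i0J : [forall s, i0 s \in J s] by apply: contraR xi0 => /J0/eqP.
have [s0 [s1 s01]] : exists s0 s1 : 'I_d, s0 != s1.
  have d0 : (0 < d)%N by rewrite (leq_trans _ d2).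
  by exists (Ordinal d0), (Ordinal d2).
have same (i : idx) k j : [forall s, i s \in J s] ->
    slot_norm x k (i k) = slot_norm x j (i j).
  move=> iJ.
  have sn0 s : slot_norm x s (i s) != 0 by have := forallP iJ s; rewrite inE.
  have P0 : \prod_j (slot_norm x j (i j) / C) != 0.
    by apply/prodf_neq0 => s _; rewrite mulf_neq0 ?invr_eq0 ?sn0.
  have xn0 : x i ^+ 2 != 0.
    by apply: contra_neq P0 => x0; rewrite -(eqs i s0) x0 mul0r.
  have : x i ^+ 2 / (slot_norm x k (i k) * C) = x i ^+ 2 / (slot_norm x j (i j) * C).
    by rewrite !eqs.
  by move=> /(mulfI xn0)/invr_inj/(mulIf Cn0).
pose p := slot_norm x s0 (i0 s0).
have pn0 : p != 0 by have := forallP i0J s0; rewrite inE.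
have p_gt0 : 0 < p by rewrite lt_def pn0 slot_norm_ge0.
have pE k a : a \in J k -> slot_norm x k a = p.
  move=> aJ; pose i := update i0 k a.
  have iJ : [forall s, i s \in J s].
    apply/forallP => s; rewrite ffunE; have [->//|_] := eqVneq.
    exact: (forallP i0J s).
  (* A second slot, where the letter is that of i0, transports the value p to slot k. *)
  have [j jk] : exists j, j != k.
    have [e|] := eqVneq s0 k; last by exists s0.
    by exists s1; rewrite eq_sym -e.
  have -> : a = i k by rewrite ffunE eqxx.
  rewrite (same i k j iJ) ffunE (negbTE jk); exact: same.
have cardJ k : #|J k|%:R * p = C.
  rewrite -(sumC k) (bigID (mem (J k)))/= [X in _ = _ + X]big1 ?addr0; last first.
    by move=> a; rewrite inE negbK => /eqP.
  by rewrite (eq_bigr (fun=> p)) ?sumr_const ?mulr_natl// => a /pE.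
have mE k : #|J k| = #|J s0|.
  by apply/eqP; rewrite -(eqr_nat R) -(inj_eq (mulIf pn0)) !cardJ.
exists #|J s0|, J, (Num.sqrt (C * p * (p / C) ^+ d)).
have m0 : (0 < #|J s0|)%N by apply/card_gt0P; exists (i0 s0); apply: (forallP i0J).
have rad_ge0 : 0 <= C * p * (p / C) ^+ d.
  by rewrite mulr_ge0 ?exprn_ge0 ?divr_ge0 ?mulr_ge0 ?ltW.
split=> //.
- by rewrite sqrtr_gt0 mulr_gt0 ?exprn_gt0 ?divr_gt0 ?mulr_gt0.
- have mr : (#|J s0|)%:R = C / p by rewrite -(cardJ s0) mulfK.
  rewrite sqr_sqrtr// mr [_ ^+ d.+1]exprS !exprMn !exprVn.
  have ? : p ^+ d != 0 by rewrite expf_neq0.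
  have ? : C ^+ d != 0 by rewrite expf_neq0.
  by field; apply/and3P.
- move=> i; case: ifP => [iJ|/negbT/J0//].
  rewrite -[LHS]ger0_norm// -sqrtr_sqr; congr Num.sqrt.
  have := eqs i s0; rewrite (pE _ _ (forallP iJ s0)).
  rewrite (eq_bigr (fun=> p / C)); last by move=> j _; rewrite pE// (forallP iJ j).
  rewrite prodr_const card_ord => /(congr1 (fun y => y * (p * C))).
  rewrite divfK ?mulf_neq0// => ->; ring.
Qed.

End Structure.

(** * Factorization of tensors whose slices have rank one *)

Section Markov.
Variables (K : fieldType) (d n : nat).
Notation idx := {ffun 'I_d -> 'I_n}.
Implicit Types (i : idx) (t : idx -> K).

Definition cross (k : nat) i i' : idx := [ffun s : 'I_d => if (s < k)%N then i s else i' s].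

(** Two words with the same letter in slot [k] may exchange their parts before
[k]: the past and the future are independent given the present. *)
Definition markov_property t : Prop := forall (k : 'I_d) i i', i k = i' k ->
  t i * t i' = t (cross k i i') * t (cross k i' i).

(** Relative to a base word [a], the ratio of two consecutive terms of the
telescoping product in [markov_factorization].  For the first pair of slots
the denominator is [t a], since that matrix also has to account for the first
letter. *)
Definition transition t (a : idx) (r : 'I_d.-1) : 'M[K]_n :=
  \matrix_(x, y) (t (update (update a (slot_l r) x) (slot_r r) y) /
     (if (r == 0 :> nat)%N then t a else t (update a (slot_l r) x))).

(** Replace the letters of [a] by those of [i] from left to right.  By the Markov
property the ratio of two successive values of [t] depends only on the last
two replaced letters. *)
Lemma markov_factorization t (J : 'I_d -> {set 'I_n}) (a i : idx) :
  (2 <= d)%N -> markov_property t ->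
  (forall i, [forall s, i s \in J s] -> t i != 0) ->
  [forall s, a s \in J s] -> [forall s, i s \in J s] ->
  t i = t a * \prod_(r < d.-1) transition t a r (i (slot_l r)) (i (slot_r r)).
Proof.
move=> d2 tM tn0 aJ iJ.
pose F m : K := if m is 0%N then t a else t (cross m.+1 i a).
have crossJ m : [forall s, cross m i a s \in J s].
  apply/forallP => s; rewrite ffunE; case: ifP => _; [exact: (forallP iJ s)|exact: (forallP aJ s)].
have Fn0 m : F m != 0 by case: m => [|m]; apply: tn0.
have Fd : F d.-1 = t i.
  rewrite /F; case E: d.-1 => [|m].
    by exfalso; move: d2 E; case: (d) => [|[|]].
  have md : m.+2 = d by rewrite -E prednK// (leq_trans _ d2).
  by congr t; apply/ffunP => s; rewrite ffunE md ltn_ord.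
have step (r : 'I_d.-1) :
    F r.+1 / F r = transition t a r (i (slot_l r)) (i (slot_r r)).
  rewrite mxE /F; case rE: (nat_of_ord r) => [|m] /=.
    congr (t _ / _); apply/ffunP => s; rewrite !ffunE.
    have [->|sr] := eqVneq s (slot_r r); first by rewrite /= rE.
    have [->|sl] := eqVneq s (slot_l r); first by rewrite /= rE.
    by move: sr sl; rewrite -!val_eqE /= rE; case: ltnP => //; lia.
  pose i2 := update a (slot_l r) (i (slot_l r)).
  have n2 : t i2 != 0.
    apply: tn0; apply/forallP => s; rewrite ffunE; case: eqVneq => [->|_].
      exact: (forallP iJ _).
    exact: (forallP aJ _).
  apply/eqP; rewrite eqr_div//; last exact: (Fn0 m.+1).
  have -> : t (cross m.+3 i a) * t i2 = t (cross (slot_l r) (cross m.+3 i a) i2) *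
     t (cross (slot_l r) i2 (cross m.+3 i a)).
    by apply: tM; rewrite !ffunE eqxx /= rE leqnSn.
  rewrite mulrC; apply/eqP; congr (t _ * t _); apply/ffunP => s; rewrite /i2 !ffunE /= rE.
    have [->|sr] := eqVneq s (slot_r r); first by rewrite /= rE; do 3?[case: ltnP => ? //]; lia.
    have [->|sl] := eqVneq s (slot_l r); first by rewrite /= rE; do 3?[case: ltnP => ? //]; lia.
    move: sr sl; rewrite -!val_eqE /= rE => sr sl.
    by case: ltnP => // ?; case: ltnP => //; lia.
  have [->|sl] := eqVneq s (slot_l r); first by rewrite /= rE; do 3?[case: ltnP => ? //]; lia.
  by move: sl; rewrite -!val_eqE /= rE => sl; do 3?[case: ltnP => ? //]; lia.
have d1 : (0 < d.-1)%N by rewrite -ltnS prednK ?(leq_trans _ d2).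
have := telescope_prodf (fun k _ => Fn0 k) d1.
rewrite big_mkord Fd (eq_bigr _ (fun r _ => step r)) => ->.
by rewrite mulrC divfK// (Fn0 0%N).
Qed.
End Markov.

(** * Orthogonality of the rows *)

Section Hadamard.
Variables (R : realType) (K : scalars R) (A : scalar_theory K) (n : nat).

Lemma abs_sqr_sum1 (I : {set 'I_n}) (m : nat) (f : 'I_n -> K) : #|I| = m ->
  (forall y, y \in I -> abs (f y) = 1) -> \sum_(y in I) f y * conjS (f y) = m%:R.
Proof.
move=> Im f1; rewrite (eq_bigr (fun=> 1)) ?sumr_const ?Im// => y yI.
by rewrite (mulconjE A) f1// expr1n rmorph1.
Qed.

(** Let [y_y] be the conjugate column [y] of [G] divided by [sqrt m], and [x_x]
the direction of [u_x = sum_y G x y y_y].  The pairing becomes [sum_x |u_x|],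
and [|u_x|^2] is [m] plus [1/m] times the sum over the other rows of the
squared inner products with row [x].  Hence each [|u_x|] is at least
[sqrt m], with equality only for orthogonal rows.  The map [code] realizes an
orthonormal family inside [W]. *)
Lemma hadamard_of_pairing (W : finType) (code : 'I_n -> W) (m : nat)
    (I I' : {set 'I_n}) (G : 'M[K]_n) :
  injective code -> (0 < m)%N -> #|I| = m -> #|I'| = m ->
  (forall x y, x \in I -> y \in I' -> abs (G x y) = 1) ->
  (forall xv yv : 'I_n -> W -> K,
     (forall x, nrm2 (xv x) <= 1) -> (forall y, y \in I' -> nrm2 (yv y) <= 1) ->
     abs (\sum_(x in I) \sum_(y in I') G x y * ip (yv y) (xv x)) <= m%:R * Num.sqrt m%:R) ->
  hadamard m I I' G.
Proof.
move=> code_inj m0 Im I'm G1 pairing.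
have mR0 : 0 < m%:R :> R by rewrite ltr0n.
have sm0 : 0 < Num.sqrt m%:R :> R by rewrite sqrtr_gt0.
pose col (h : 'I_n -> K) (g : W) : K := \sum_(x in I) (g == code x)%:R * h x.
have nrm2_col h : nrm2 (col h) = \sum_(x in I) abs (h x) ^+ 2.
  have col_code x : x \in I -> col h (code x) = h x.
    move=> xI; rewrite /col (bigD1 x)//= eqxx mul1r big1 ?addr0// => x' /andP[_ x'x].
    by rewrite (inj_eq code_inj) eq_sym (negbTE x'x) mul0r.
  rewrite /nrm2 (bigID (mem (code @: I)))/= [X in _ + X]big1 ?addr0; last first.
    move=> g gI; suff -> : col h g = 0 by rewrite (abs0 A) expr0n.
    apply: big1 => x xI; case: eqVneq => [gx|_]; last by rewrite mul0r.
    by move: gI; rewrite gx imset_f.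
  rewrite big_imset/=; last by move=> x y _ _; exact: code_inj.
  by apply: eq_bigr => x /col_code ->.
pose gam x x' : K := \sum_(y in I') G x y * conjS (G x' y).
pose yv y := col (fun x => conjS (G x y) * inR A (Num.sqrt m%:R)^-1).
pose u x (g : W) : K := \sum_(y in I') G x y * yv y g.
have sm2 : inR A (Num.sqrt m%:R)^-1 * inR A (Num.sqrt m%:R)^-1 = inR A m%:R^-1.
  by rewrite -rmorphM -invfM -expr2 sqr_sqrtr// ltW.
have yv1 y : y \in I' -> nrm2 (yv y) <= 1.
  move=> yI'; rewrite nrm2_col (eq_bigr (fun=> m%:R^-1)); last first.
    move=> x xI; rewrite (absM A) (abs_conj A) G1// mul1r (abs_inR A) ger0_norm ?invr_ge0 ?ltW//.
    by rewrite exprVn sqr_sqrtr// ltW.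
  by rewrite sumr_const Im -[X in X <= _]mulr_natr mulVf// gt_eqF.
have uE x : nrm2 (u x) = m%:R^-1 * \sum_(x' in I) abs (gam x x') ^+ 2.
  have -> : nrm2 (u x) = nrm2 (col (fun x' => gam x x' * inR A (Num.sqrt m%:R)^-1)).
    apply: eq_bigr => g _; congr (abs _ ^+ 2).
    rewrite /u; under eq_bigr do rewrite mulr_sumr.
    rewrite exchange_big; apply: eq_bigr => x' _ /=.
    rewrite mulr_suml mulr_sumr; apply: eq_bigr => y _; ring.
  rewrite nrm2_col mulr_sumr; apply: eq_bigr => x' _.
  rewrite (absM A) (abs_inR A) exprMn real_normK ?num_real// exprVn sqr_sqrtr ?(ltW mR0)//.
  by rewrite mulrC.
pose xv x (g : W) : K := u x g * inR A (Num.sqrt (nrm2 (u x)))^-1.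
have xv1 x : nrm2 (xv x) <= 1.
  have -> : nrm2 (xv x) = (nrm2 (u x))^-1 * nrm2 (u x).
    rewrite [in RHS]/nrm2 mulr_sumr; apply: eq_bigr => g _.
    rewrite (absM A) (abs_inR A) exprMn real_normK ?num_real// exprVn sqr_sqrtr ?nrm2_ge0//.
    by rewrite mulrC.
  by have [->|?] := eqVneq (nrm2 (u x)) 0; rewrite ?mulr0// mulVf.
have gamxx x : x \in I -> gam x x = m%:R.
  by move=> xI; apply: abs_sqr_sum1 => // y yI'; exact: G1.
have u_split x : x \in I -> nrm2 (u x) =
    m%:R + m%:R^-1 * \sum_(x' in I | x' != x) abs (gam x x') ^+ 2.
  move=> xI; rewrite uE (bigD1 x)//= mulrDr gamxx//.
  have -> : (m%:R : K) = inR A m%:R by rewrite rmorph_nat.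
  by rewrite (abs_inR A) real_normK ?num_real// expr2 mulKf// gt_eqF.
have rest0 x : 0 <= \sum_(x' in I | x' != x) abs (gam x x') ^+ 2.
  by apply: sumr_ge0 => *; rewrite sqr_ge0.
have := pairing xv yv xv1 yv1.
rewrite (eq_bigr (fun x => inR A (Num.sqrt (nrm2 (u x))))); last first.
  move=> x xI; transitivity (ip (u x) (xv x)).
    rewrite /ip [RHS](eq_bigr (fun g =>
      \sum_(y in I') G x y * yv y g * conjS (xv x g))); last first.
      by move=> g _; rewrite mulr_suml.
    rewrite exchange_big; apply: eq_bigr => y _; rewrite mulr_sumr.
    by apply: eq_bigr => g _; rewrite mulrA.
  transitivity (ip (u x) (u x) * inR A (Num.sqrt (nrm2 (u x)))^-1).
    rewrite /ip mulr_suml; apply: eq_bigr => g _.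
    by rewrite /xv (conjSM A) conjS_inR mulrA.
  rewrite (ipuu A) -rmorphM; congr (inR A _).
  have [->|nu0] := eqVneq (nrm2 (u x)) 0; first by rewrite mul0r sqrtr0.
  have s0 : Num.sqrt (nrm2 (u x)) != 0.
    by rewrite sqrtr_eq0 -ltNge lt_def nu0 nrm2_ge0.
  by rewrite -{1}(sqr_sqrtr (nrm2_ge0 (u x))) expr2 mulfK.
rewrite -rmorph_sum (abs_inR A) ger0_norm ?sumr_ge0// => le_sum.
have gt x : x \in I -> Num.sqrt m%:R <= Num.sqrt (nrm2 (u x)) ?= iff
     (\sum_(x' in I | x' != x) abs (gam x x') ^+ 2 == 0).
  move=> xI; rewrite u_split//; set rest := \sum_(_ in I | _) _.
  have r0 : 0 <= m%:R^-1 * rest by rewrite mulr_ge0 ?invr_ge0 ?(ltW mR0)//; exact: rest0.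
  split; first by rewrite ler_wsqrtr// lerDl.
  rewrite eqr_sqrt ?addr_ge0 ?(ltW mR0)// eq_sym -subr_eq0 addrAC subrr add0r.
  by rewrite mulf_eq0 invr_eq0 (gt_eqF mR0).
have := leif_sum gt; rewrite sumr_const Im -[X in X <= _ ?= iff _]mulr_natl.
move=> /ge_leif; rewrite le_sum => /esym/forall_inP gam0.
split=> //.
  by move=> x y xI yI'; apply/(norm_eq1 A); exact: G1.
move=> x x' xI x'I; case: eqVneq => [<-|xx']; first exact: gamxx.
have := gam0 x xI.
rewrite psumr_eq0 => [/allP/(_ x' (mem_index_enum _))|*]; last by rewrite sqr_ge0.
by rewrite x'I eq_sym xx' /= sqrf_eq0 (abs_eq0 A) => /eqP.
Qed.

End Hadamard.

Lemma card_ffun_forall (S V : finType) (F : S -> pred V) :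
  #|[pred f : {ffun S -> V} | [forall s, F s (f s)]]| = (\prod_s #|F s|)%N.
Proof.
rewrite -sum1_card (eq_bigr (fun s => \sum_(v | F s v) 1)%N); last first.
  by move=> s _; rewrite sum1_card.
rewrite bigA_distr_big_dep; apply: eq_big => [f|f _]; last by rewrite big1_eq.
by apply/forallP/familyP.
Qed.

Section ChainPairing.
Variables (R : realType) (K : scalars R) (A : scalar_theory K).

Lemma rank_one_contractive (W : finType) (al xi : W -> K) :
  nrm2 al <= 1 -> nrm2 xi <= 1 ->
  contractive (kernel_op (A := A) (fun f g => al f * conjS (xi g))).
Proof.
move=> al1 xi1 u.
have -> : nrm2 (kernel_op (A := A) (fun f g => al f * conjS (xi g)) u : W -> K) =
    abs (ip (u : W -> K) xi) ^+ 2 * nrm2 al.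
  rewrite mulr_sumr; apply: eq_bigr => f _; rewrite ffunE -exprMn -(absM A).
  congr (abs _ ^+ 2); rewrite mulr_suml; apply: eq_bigr => g _.
  by rewrite -mulrA mulrC [conjS _ * _]mulrC.
apply: (@le_trans _ _ (abs (ip (u : W -> K) xi) ^+ 2)); first by rewrite ler_piMr ?sqr_ge0.
by apply: (le_trans (cauchy_schwarz A _ _)); rewrite ler_piMr ?nrm2_ge0.
Qed.

Variables (d n : nat).
Notation idx := {ffun 'I_d -> 'I_n}.
Variables (m : nat) (J : 'I_d -> {set 'I_n}).
Hypothesis (m_gt0 : (0 < m)%N) (cardJ : forall s, #|J s| = m).

(** The partial words whose set of filled slots is exactly [P], with letters
allowed by [J]. *)
Definition words (P : pred 'I_d) : pred (pword d n) :=
  [pred f : pword d n |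
    [forall s, if P s then oapp (fun x => x \in J s) false (f s) else f s == None]].

Lemma prod_card_select (P : pred 'I_d) :
  (\prod_s (if P s then m else 1) = m ^ (\sum_s P s))%N.
Proof. by rewrite expn_sum; apply: eq_bigr => s _; case: (P s). Qed.

Lemma card_words (P : pred 'I_d) : #|words P| = (m ^ (\sum_s P s))%N.
Proof.
have Si : injective (@Some 'I_n) by move=> ? ? [].
rewrite /words (card_ffun_forall (fun s (o : option 'I_n) =>
   if P s then oapp (fun x => x \in J s) false o else o == None)).
rewrite -prod_card_select; apply: eq_bigr => s _; case: (P s).
  rewrite -(cardJ s) -(fintype.card_image Si); apply: eq_card => -[x|].
    by rewrite fintype.mem_image.
  by rewrite unfold_in /=; apply/esym/negbTE/mapP => -[].
by rewrite -(card1 (@None 'I_n)); apply: eq_card.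
Qed.

Lemma nrm2_words (P : pred 'I_d) (h : pword d n -> K) :
  (forall f, words P f -> abs (h f) = 1) ->
  nrm2 (fun f => if words P f then h f * inR A (Num.sqrt (m ^ (\sum_s P s))%:R)^-1 else 0) <= 1.
Proof.
move=> h1; set e := (m ^ _)%N.
have e0 : 0 < e%:R :> R by rewrite ltr0n expn_gt0 m_gt0.
rewrite /nrm2 (bigID (words P))/= [X in _ + X]big1 ?addr0; last first.
  by move=> f /negbTE ->; rewrite (abs0 A) expr0n.
rewrite (eq_bigr (fun=> e%:R^-1)); last first.
  move=> f wf; rewrite wf (absM A) h1// mul1r (abs_inR A) real_normK ?num_real//.
  by rewrite exprVn sqr_sqrtr// ltW.
by rewrite sumr_const card_words -[X in X <= _]mulr_natr mulVf// gt_eqF.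
Qed.

Variables (T : {ffun 'I_d -> 'rV[K]_n} -> K) (C c : R) (lambda : K).
Variable G : 'I_d.-1 -> 'M[K]_n.
Hypothesis cbC : (cb_norm T <= C%:E)%E.
Hypothesis (C_gt0 : 0 < C) (c_gt0 : 0 < c) (Cc : C ^+ 2 = c ^+ 2 * m%:R ^+ d.+1).
Hypothesis abs_lambda : abs lambda = c.
Hypothesis abs_G : forall r x y, x \in J (slot_l r) -> y \in J (slot_r r) -> abs (G r x y) = 1.
Hypothesis coefE : forall i : idx, coef T i = if [forall s, i s \in J s]
  then lambda * \prod_r G r (i (slot_l r)) (i (slot_r r)) else 0.

Variable r : 'I_d.-1.
Let sl := slot_l r.
Let sr := slot_r r.
Let al (i : idx) : K := \prod_(r' : 'I_d.-1 | (r' < r)%N) G r' (i (slot_l r')) (i (slot_r r')).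
Let be (i : idx) : K := \prod_(r' : 'I_d.-1 | (r < r')%N) G r' (i (slot_l r')) (i (slot_r r')).

Let fill (x : 'I_n) (f : pword d n) : idx := [ffun s => odflt x (f s)].

Let prodG (i : idx) : \prod_r G r (i (slot_l r)) (i (slot_r r)) = al i * G r (i sl) (i sr) * be i.
Proof.
rewrite (bigD1 r)//= (bigID (fun r' : 'I_d.-1 => (r' < r)%N))/= mulrA [G r _ _ * _]mulrC.
congr (_ * _ * _).
  by apply: eq_bigl => r'; rewrite -val_eqE /=; case: ltngtP.
by apply: eq_bigl => r'; rewrite -val_eqE /=; case: ltngtP.
Qed.

Let al_fill (i : idx) : al (fill (i sl) (below i r)) = al i.
Proof.
apply: eq_bigr => r' lt_r'r; rewrite !ffunE /= lt_r'r /=; congr (G r' _ _).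
case: ltnP => //= r_le; congr (i _); apply: val_inj => /=; lia.
Qed.

Let be_fill (i : idx) : be (fill (i sr) (above i r.+2)) = be i.
Proof.
apply: eq_bigr => r' lt_rr'; rewrite !ffunE /= [(r.+2 <= r'.+1)%N]ltnS lt_rr' /=; congr (G r' _ _).
case: ltnP => //= r_le; congr (i _); apply: val_inj => /=; lia.
Qed.

Let PL : pred 'I_d := fun s => (s < r)%N.
Let PR : pred 'I_d := fun s => (r.+2 <= s)%N.
Let eL := (\sum_s PL s)%N.
Let eR := (\sum_s PR s)%N.

Let abs_prod1 (Q : pred 'I_d.-1) (i : idx) :
  (forall r', Q r' -> i (slot_l r') \in J (slot_l r') /\ i (slot_r r') \in J (slot_r r')) ->
  abs (\prod_(r' | Q r') G r' (i (slot_l r')) (i (slot_r r'))) = 1.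
Proof.
move=> h; rewrite (big_morph _ (absM A) (abs1 A)); apply: big1 => r' /h[].
exact: abs_G.
Qed.

Let abs_al x f : x \in J sl -> words PL f -> abs (al (fill x f)) = 1.
Proof.
move=> xJ /forallP fw; apply: abs_prod1 => r' r'r.
have h (s : 'I_d) : (s <= r)%N -> fill x f s \in J s.
  move=> s_r; rewrite ffunE; have := fw s; rewrite /PL; case: ltnP => [sr'|rs].
    by case: (f s).
  move=> /eqP -> /=; rewrite (_ : s = sl)//; apply: val_inj => /=; lia.
by split; apply: h => /=; lia.
Qed.

Let abs_be y f : y \in J sr -> words PR f -> abs (be (fill y f)) = 1.
Proof.
move=> yJ /forallP fw; apply: abs_prod1 => r' r'r.
have h (s : 'I_d) : (r.+1 <= s)%N -> fill y f s \in J s.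
  move=> rs; rewrite ffunE; have := fw s; rewrite /PR; case: ltnP => [sr'|rs'].
    by case: (f s).
  move=> /eqP -> /=; rewrite (_ : s = sr)//; apply: val_inj => /=; lia.
by split; apply: h => /=; lia.
Qed.

Let card_fixed x y : x \in J sl -> y \in J sr ->
  #|[pred i : idx | [forall s, i s \in J s] && ((i sl, i sr) == (x, y))]| = (m ^ (eL + eR))%N.
Proof.
move=> xJ yJ.
(* One letter is allowed in the slots r and r + 1, and m letters in the others. *)
pose F (s : 'I_d) : pred 'I_n :=
  [pred v | [&& v \in J s, (s == sl) ==> (v == x) & (s == sr) ==> (v == y)]].
have slr : (sl == sr) = false by apply/negbTE; rewrite -val_eqE /= ltn_eqF.
have -> : #|[pred i : idx | [forall s, i s \in J s] && ((i sl, i sr) == (x, y))]| =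
    #|[pred i : idx | [forall s, F s (i s)]]|.
  apply: eq_card => i; rewrite !inE xpair_eqE; apply/and3P/forallP.
    move=> [/forallP iJ /eqP ix /eqP iy] s; rewrite /F /= iJ /=.
    by apply/andP; split; apply/implyP => /eqP ->; apply/eqP.
  move=> h; have hJ s : i s \in J s by have /and3P[] := h s.
  split; first exact/forallP.
    by have /and3P[_ /implyP/(_ (eqxx _))] := h sl.
  by have /and3P[_ _ /implyP/(_ (eqxx _))] := h sr.
rewrite (card_ffun_forall F) /eL /eR -big_split /=.
rewrite [X in _ = (m ^ X)%N](eq_bigr (fun s => nat_of_bool ((s != sl) && (s != sr)))); last first.
  move=> s _; rewrite /PL /PR -!val_eqE /=.
  by case: (ltngtP s r) => h1; case: (ltngtP s r.+1) => h2 //=; lia.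
rewrite -prod_card_select; apply: eq_bigr => s _.
have [->|sl'] /= := eqVneq s sl.
  rewrite -(card1 x); apply: eq_card => v; rewrite !inE eqxx slr /= andbT.
  by case: eqVneq => [->|]; rewrite ?xJ ?andbF.
have [->|sr'] /= := eqVneq s sr.
  rewrite -(card1 y); apply: eq_card => v; rewrite !inE eqxx eq_sym slr /=.
  by case: eqVneq => [->|]; rewrite ?yJ ?andbF.
rewrite -(cardJ s); apply: eq_card => v.
by rewrite !inE (negbTE sl') (negbTE sr') andbT.
Qed.

Let eLR : (eL + eR).+2 = d.
Proof.
have slr : (sl == sr) = false by apply/negbTE; rewrite -val_eqE /= ltn_eqF.
have sum1 (s0 : 'I_d) : (\sum_(s : 'I_d) (s == s0) = 1)%N.
  by rewrite (bigD1 s0)//= eqxx big1// => s /negbTE ->.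
have : (\sum_(s : 'I_d) (PL s + PR s + (s == sl) + (s == sr)) = d)%N.
  rewrite -[RHS]card_ord -sum1_card; apply: eq_bigr => s _; rewrite /PL /PR -!val_eqE /=.
  by case: (ltngtP s r) => h1; case: (ltngtP s r.+1) => h2 //=; lia.
by rewrite !big_split /= !sum1 !addn1.
Qed.

(** The slots [r] and [r + 1] act by rank-one operators.  Their outer vectors are
the normalized conjugates of the phases contributed by the slots before [r]
and after [r + 1], so that these phases cancel, and their inner vectors are
the given [xv] and [yv].  There are [m ^ (d - 2)] choices for the other
letters and the normalization costs the square root of this number. *)
Lemma chain_pairing_le (xv yv : 'I_n -> pword d n -> K) :
  (forall x, nrm2 (xv x) <= 1) -> (forall y, y \in J sr -> nrm2 (yv y) <= 1) ->
  abs (\sum_(x in J sl) \sum_(y in J sr) G r x y * ip (yv y) (xv x)) <= m%:R * Num.sqrt m%:R.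
Proof.
move=> xv1 yv1.
pose kL := inR A (Num.sqrt (m ^ eL)%:R)^-1.
pose kR := inR A (Num.sqrt (m ^ eR)%:R)^-1.
pose aL x f := if x \in J sl then (if words PL f then conjS (al (fill x f)) * kL else 0) else 0.
pose bR y f := if words PR f then be (fill y f) * kR else 0.
pose M x : {linear l2 A (pword d n) -> l2 A (pword d n)} :=
  kernel_op (A := A) (fun f g => aL x f * conjS (xv x g)).
pose N y : {linear l2 A (pword d n) -> l2 A (pword d n)} :=
  kernel_op (A := A) (fun f g =>
    (if y \in J sr then yv y f else 0) * conjS (if y \in J sr then bR y g else 0)).
have nrm2_0 : nrm2 (fun _ : pword d n => 0 : K) <= 1.
  by rewrite /nrm2 big1// => *; rewrite (abs0 A) expr0n.
have Mc x : contractive (M x).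
  apply: rank_one_contractive => //; rewrite /aL; case xJ: (x \in J sl) => //.
  apply: (nrm2_words (h := fun f => conjS (al (fill x f)))) => f fw.
  by rewrite (abs_conj A); exact: abs_al.
have Nc y : contractive (N y).
  apply: rank_one_contractive; case yJ: (y \in J sr) => //; first exact: yv1.
  by apply: (nrm2_words (h := fun f => be (fill y f))) => f fw; exact: abs_be.
pose E (i : idx) (t : nat) : l2 A (pword d n) :=
  if (r.+2 <= t)%N then delta A (above i t)
  else if t == r.+1 then N (i sr) (delta A (above i r.+2))
  else M (i sl) (N (i sr) (delta A (above i r.+2))).
have slr : (sr == sl) = false by apply/negbTE; rewrite -val_eqE /= gtn_eqF.
have cb_bound : ((abs (\sum_(i : idx) coef T i * E i r (below i r)))%:E <= cb_norm T)%E.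
  apply: (@word_pairing_le_cb _ _ A d n T r r.+2 (fun s j => if s == sl then M j else N j) E).
  - by move=> s j; case: ifP.
  - by move=> i t rt; rewrite /E rt.
  - move=> i s /andP[rs]; rewrite ltnS leq_eqVlt => /predU1P[s_eq|s_lt].
      have -> : s = sr by apply: val_inj.
      by rewrite slr /E /= leqnn ltnn eqxx.
    have -> : s = sl by apply: val_inj => /=; lia.
    by rewrite eqxx /E /= eqxx !ltnn (ltn_eqF (ltnSn r)) (leqNgt r.+2) ltnS leqnSn.
  - by have := valP sr; rewrite /=; lia.
have EE (i : idx) : [forall s, i s \in J s] -> coef T i * E i r (below i r) =
    lambda * (kL * kR) * (G r (i sl) (i sr) * ip (yv (i sr)) (xv (i sl))).
  move=> iJ; have hJ s : i s \in J s := forallP iJ s.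
  have -> : E i r (below i r) = aL (i sl) (below i r) * (conjS (bR (i sr) (above i r.+2)) *
      ip (yv (i sr)) (xv (i sl))).
    rewrite /E ltnNge leqnSn /= (ltn_eqF (ltnSn r)) ffunE !mulr_sumr.
    apply: eq_bigr => g _; rewrite ffunE (bigD1 (above i r.+2))//= big1 ?addr0; last first.
      by move=> f /negbTE fi; rewrite ffunE fi mulr0.
    by rewrite ffunE eqxx mulr1 hJ; ring.
  have -> : aL (i sl) (below i r) = conjS (al i) * kL.
    rewrite /aL hJ al_fill ifT//; apply/forallP => s; rewrite ffunE /PL.
    by case: (s < r)%N => //=; exact: hJ.
  have -> : bR (i sr) (above i r.+2) = be i * kR.
    rewrite /bR be_fill ifT//; apply/forallP => s; rewrite ffunE /PR.
    by case: (r.+2 <= s)%N => //=; exact: hJ.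
  have al1 : al i * conjS (al i) = 1.
    by rewrite (mulconjE A) abs_prod1 ?expr1n ?rmorph1// => r' _; split; exact: hJ.
  have be1 : be i * conjS (be i) = 1.
    by rewrite (mulconjE A) abs_prod1 ?expr1n ?rmorph1// => r' _; split; exact: hJ.
  rewrite coefE iJ prodG (conjSM A) conjS_inR -/kR.
  transitivity ((al i * conjS (al i)) * (be i * conjS (be i)) * (lambda * (kL * kR) *
      (G r (i sl) (i sr) * ip (yv (i sr)) (xv (i sl))))); first by ring.
  by rewrite al1 be1 !mul1r.
set Phi := \sum_(x in _) _.
have sumE : \sum_(i : idx) coef T i * E i r (below i r) =
    lambda * (kL * kR) * (m ^ (eL + eR))%:R * Phi.
  rewrite (bigID (fun i : idx => [forall s, i s \in J s]))/= [X in _ + X]big1 ?addr0; last first.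
    by move=> i /negbTE iJ; rewrite coefE iJ mul0r.
  rewrite (partition_big (fun i : idx => (i sl, i sr))
    (fun p : 'I_n * 'I_n => (p.1 \in J sl) && (p.2 \in J sr)))/=; last first.
    by move=> i /forallP iJ; rewrite !iJ.
  rewrite /Phi pair_big mulr_sumr; apply: eq_bigr => -[x y] /= /andP[xJ yJ].
  rewrite (eq_bigr (fun=> lambda * (kL * kR) * (G r x y * ip (yv y) (xv x)))); last first.
    by move=> i /andP[iJ /eqP[<- <-]]; exact: EE.
  rewrite sumr_const card_fixed// -[LHS]mulr_natr; ring.
have := le_trans cb_bound cbC; rewrite lee_fin sumE !(absM A) abs_lambda -[c * _ * _]mulrA.
have mE k : (0 : R) < (m ^ k)%:R by rewrite ltr0n expn_gt0 m_gt0.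
have -> : abs kL * abs kR * abs ((m ^ (eL + eR))%:R : K) = Num.sqrt (m ^ (eL + eR))%:R.
  rewrite !(abs_inR A) !ger0_norm ?invr_ge0 ?sqrtr_ge0//.
  rewrite -(rmorph_nat (inR A)) (abs_inR A) ger0_norm// -invfM -sqrtrM ?ler0n//.
  rewrite -natrM -expnD -[X in _ * X]sqr_sqrtr ?ler0n// expr2 mulrA mulVf ?mul1r//.
  by rewrite sqrtr_eq0 -ltNge.
(* The exponents satisfy eL + eR + 2 = d, which makes the two sides comparable. *)
have CE : C = c * Num.sqrt (m ^ (eL + eR))%:R * (m%:R * Num.sqrt m%:R).
  have rhs0 : 0 <= c * Num.sqrt (m ^ (eL + eR))%:R * (m%:R * Num.sqrt m%:R) :> R.
    by rewrite !mulr_ge0 ?sqrtr_ge0 ?ler0n ?(ltW c_gt0).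
  apply/eqP; rewrite -(eqrXn2 (n := 2)) ?(ltW C_gt0)//.
  have d3 : m%:R ^+ d.+1 = m%:R ^+ (eL + eR) * m%:R ^+ 3 :> R.
    by rewrite -exprD addn3 eLR.
  rewrite Cc d3 !exprMn !sqr_sqrtr ?ler0n// natrX; apply/eqP.
  by ring.
rewrite {1}CE ler_pM2l// mulr_gt0// sqrtr_gt0; exact: mE.
Qed.
End ChainPairing.

(** * Chains of Hadamard matrices *)

Section FfunCons.
Variables (S : finType) (k : nat).

Definition ffun_cons (x : S) (f : {ffun 'I_k -> S}) : {ffun 'I_k.+1 -> S} :=
  [ffun s => if unlift ord0 s is Some s' then f s' else x].

Lemma ffun_cons0 x f : ffun_cons x f ord0 = x.
Proof. by rewrite ffunE unlift_none. Qed.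

Lemma ffun_consS x f s : ffun_cons x f (lift ord0 s) = f s.
Proof. by rewrite ffunE liftK. Qed.

(** Splits the first letter off a word; this drives the induction on the number
of slots. *)
Lemma sum_ffun_recl (V : nmodType) (F : {ffun 'I_k.+1 -> S} -> V) :
  \sum_f F f = \sum_x \sum_f F (ffun_cons x f).
Proof.
rewrite pair_bigA /= (reindex (fun p : S * {ffun 'I_k -> S} => ffun_cons p.1 p.2))//=.
exists (fun f : {ffun 'I_k.+1 -> S} => (f ord0, [ffun s => f (lift ord0 s)])).
  move=> [x f] _ /=; rewrite ffun_cons0; congr (_, _); apply/ffunP => s.
  by rewrite ffunE ffun_consS.
move=> f _; apply/ffunP => s /=; case: (unliftP ord0 s) => [s' ->|->].
  by rewrite ffun_consS ffunE.
by rewrite ffun_cons0.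
Qed.

End FfunCons.

Section Converse.
Variables (R : realType) (K : scalars R) (A : scalar_theory K) (n : nat).
Variable H : hilbert K.

Lemma op_norm_le1 (X : {linear H -> H}) : (op_norm X <= 1)%E -> forall u, `|X u| <= `|u|.
Proof.
move=> X1 u; have [->|u0] := eqVneq u 0; first by rewrite linear0.
have nu0 : `|u| != 0 by rewrite normr_eq0.
pose y := `|u|^-1 *: u.
have y1 : `|y| = 1 by rewrite normrZ normfV normr_id mulVf.
have : (((reS `|X y|)%:E <= op_norm X)%E).
  by apply: ereal_sup_ubound; exists y => //=; rewrite y1.
move=> /le_trans/(_ X1); rewrite lee_fin -(le_inR A).
have -> : inR A (reS `|X y|) = `|X y|.
  by have := inR_norm A `|X y|; rewrite normr_id.
rewrite rmorph1 linearZ normrZ normfV normr_id mulrC ler_pdivrMr ?mul1r//.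
by rewrite normr_gt0.
Qed.

Lemma dotBl (u v w : H) : dot H (u - v) w = dot H u w - dot H v w.
Proof. exact: (@zmod_morphisml_subproof _ _ _ _ _ _ (dot H)). Qed.

Lemma dotBr (u v w : H) : dot H u (v - w) = dot H u v - dot H u w.
Proof. exact: (@zmod_morphismr_subproof _ _ _ _ _ _ (dot H)). Qed.

Lemma dotZl (c : K) (u v : H) : dot H (c *: u) v = c * dot H u v.
Proof. exact: (@linearl_subproof _ _ _ _ _ _ (dot H)). Qed.

Lemma dotZr (c : K) (u v : H) : dot H u (c *: v) = conjS c * dot H u v.
Proof. exact: (@linearr_subproof _ _ _ _ _ _ (dot H)). Qed.

Lemma dot0l (v : H) : dot H 0 v = 0.
Proof. by rewrite -[0 in LHS](subrr v) dotBl subrr. Qed.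

Lemma dot0r (v : H) : dot H v 0 = 0.
Proof. by rewrite -[0 in LHS](subrr v) dotBr subrr. Qed.

Lemma dotDl (u v w : H) : dot H (u + v) w = dot H u w + dot H v w.
Proof. by rewrite -[v in LHS]opprK dotBl -[- v]sub0r dotBl dot0l sub0r opprK. Qed.

Lemma dotDr (u v w : H) : dot H u (v + w) = dot H u v + dot H u w.
Proof. by rewrite -[w in LHS]opprK dotBr -[- w]sub0r dotBr dot0r sub0r opprK. Qed.

Lemma dot_suml (I : Type) (s : seq I) (P : pred I) (u : I -> H) v :
  dot H (\sum_(i <- s | P i) u i) v = \sum_(i <- s | P i) dot H (u i) v.
Proof. exact: (big_morph (fun x => dot H x v) (fun x y => dotDl x y v) (dot0l v)). Qed.

Lemma dot_sumr (I : Type) (s : seq I) (P : pred I) (u : I -> H) v :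
  dot H v (\sum_(i <- s | P i) u i) = \sum_(i <- s | P i) dot H v (u i).
Proof. exact: (big_morph (dot H v) (dotDr v) (dot0r v)). Qed.

(** Let [w = G u] and [z = G^* w].  Since [G G^* = m], the sum of the [|z_y|^2] is
[m] times that of the [|w_x|^2], which is also the pairing of [u] with [z];
expanding [|z - m u|^2 >= 0] gives the claim. *)
Lemma hadamard_bounded (m : nat) (I I' : {set 'I_n}) (G : 'M[K]_n) (u : 'I_n -> H) :
  (0 < m)%N -> hadamard m I I' G ->
  \sum_(x in I) `|\sum_(y in I') G x y *: u y| ^+ 2 <= m%:R * \sum_(y in I') `|u y| ^+ 2.
Proof.
move=> m0 [_ _ _ GG].
pose w x := \sum_(y in I') G x y *: u y.
pose z y := \sum_(x in I) conjS (G x y) *: w x.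
pose Sw := \sum_(x in I) `|w x| ^+ 2.
pose Su := \sum_(y in I') `|u y| ^+ 2.
have uz : \sum_(y in I') dot H (u y) (z y) = Sw.
  under eq_bigr => y _.
    rewrite dot_sumr; under eq_bigr do rewrite dotZr (conjSK A).
    over.
  rewrite exchange_big; apply: eq_bigr => x _ /=.
  by rewrite dot_norm [in RHS]/w dot_suml; apply: eq_bigr => y _; rewrite dotZl.
have zu : \sum_(y in I') dot H (z y) (u y) = Sw.
  under eq_bigr => y _.
    rewrite dot_suml; under eq_bigr do rewrite dotZl.
    over.
  rewrite exchange_big; apply: eq_bigr => x _ /=.
  by rewrite dot_norm [X in dot H _ X]/w dot_sumr; apply: eq_bigr => y _; rewrite dotZr.
have zz : \sum_(y in I') dot H (z y) (z y) = m%:R * Sw.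
  transitivity (\sum_(x in I) \sum_(x' in I)
      (\sum_(y in I') G x' y * conjS (G x y)) * dot H (w x) (w x')).
    under eq_bigr => y _.
      rewrite dot_suml; under eq_bigr => x _.
        rewrite dotZl dot_sumr mulr_sumr.
        under eq_bigr do rewrite dotZr (conjSK A).
        over.
      over.
    rewrite exchange_big; apply: eq_bigr => x _; rewrite exchange_big; apply: eq_bigr => x' _.
    by rewrite mulr_suml; apply: eq_bigr => y _; ring.
  rewrite mulr_sumr; apply: eq_bigr => x xI.
  rewrite (bigD1 x)//= [X in _ + X]big1 ?addr0; last first.
    by move=> x' /andP[x'I /negbTE x'x]; rewrite GG// x'x mul0r.
  by rewrite GG// eqxx dot_norm.
have cm : conjS (m%:R : K) = m%:R by rewrite -(rmorph_nat (inR A)) conjS_inR.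
have : 0 <= \sum_(y in I') `|z y - m%:R *: u y| ^+ 2.
  by apply: sumr_ge0 => y _; rewrite exprn_ge0.
under eq_bigr do rewrite dot_norm dotBl !dotBr !dotZl !dotZr cm.
rewrite !sumrB -!mulr_sumr zz zu uz.
under eq_bigr do rewrite -dot_norm.
rewrite -/Su subrr sub0r opprB subr_ge0 ler_pM2l ?ltr0n//.
Qed.
End Converse.

Section ChainNorm.
Variables (R : realType) (K : scalars R) (A : scalar_theory K) (n m : nat).
Variables (H : hilbert K) (v : H).
Hypothesis m_gt0 : (0 < m)%N.
Notation comp := (fun f g : H -> H => f \o g).

(** Fixing the first letter makes the recursion [chain_sumS] possible. *)
Definition chain_sum (k : nat) (J : 'I_k.+1 -> {set 'I_n}) (G : 'I_k -> 'M[K]_n)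
    (X : 'I_k.+1 -> 'I_n -> {linear H -> H}) (x : 'I_n) : H :=
  \sum_(i : {ffun 'I_k.+1 -> 'I_n} | [forall s, i s \in J s] && (i ord0 == x))
    (\prod_(r < k) G r (i (@slot_l k.+1 r)) (i (@slot_r k.+1 r))) *:
    (\big[comp/idfun]_(s < k.+1) (X s (i s) : H -> H)) v.

Lemma chain_sum0 (J : 'I_1 -> {set 'I_n}) (G : 'I_0 -> 'M[K]_n)
    (X : 'I_1 -> 'I_n -> {linear H -> H}) x :
  x \in J ord0 -> chain_sum (k := 0) J G X x = X ord0 x v.
Proof.
move=> xJ; rewrite /chain_sum (big_pred1 [ffun=> x]) => [|i].
  by rewrite big_ord0 scale1r big_ord_recl big_ord0 /= ffunE.
apply/andP/eqP => [[_ /eqP ix]|->].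
  by apply/ffunP => s; rewrite ffunE (ord1 s).
by split; [apply/forallP => s; rewrite ffunE (ord1 s) | rewrite ffunE].
Qed.

Lemma chain_sumS k (J : 'I_k.+2 -> {set 'I_n}) (G : 'I_k.+1 -> 'M[K]_n)
    (X : 'I_k.+2 -> 'I_n -> {linear H -> H}) x :
  x \in J ord0 ->
  chain_sum J G X x = X ord0 x (\sum_(y in J (lift ord0 ord0)) G ord0 x y *:
     chain_sum (fun s => J (lift ord0 s)) (fun r => G (lift ord0 r))
               (fun s => X (lift ord0 s)) y).
Proof.
move=> xJ; rewrite linear_sum /=.
pose term (f : {ffun 'I_k.+1 -> 'I_n}) : H :=
  (\prod_(r < k) G (lift ord0 r) (f (@slot_l k.+1 r)) (f (@slot_r k.+1 r))) *:
    (\big[comp/idfun]_(s < k.+1) (X (lift ord0 s) (f s) : H -> H)) v.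
(* Words starting with x correspond to words on the remaining slots. *)
pose fJ (f : {ffun 'I_k.+1 -> 'I_n}) := [forall s, f s \in J (lift ord0 s)].
transitivity (\sum_(f | fJ f) G ord0 x (f ord0) *: X ord0 x (term f)).
  rewrite /chain_sum big_mkcond sum_ffun_recl (bigD1 x)//= [X in _ + X]big1 ?addr0; last first.
    move=> y yx; apply: big1 => f _; rewrite ffun_cons0 (negbTE yx) andbF//.
  rewrite [RHS]big_mkcond; apply: eq_bigr => f _; rewrite ffun_cons0 eqxx andbT.
  have -> : [forall s, ffun_cons x f s \in J s] = fJ f.
    apply/forallP/forallP => h s; first by have := h (lift ord0 s); rewrite ffun_consS.
    by case: (unliftP ord0 s) => [s' ->|->]; rewrite ?ffun_consS ?ffun_cons0.
  case: ifP => // _; rewrite big_ord_recl [X in _ *: X v]big_ord_recl /= -scalerA.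
  have sl0 : @slot_l k.+2 ord0 = ord0 by exact: val_inj.
  have sr0 : @slot_r k.+2 ord0 = lift ord0 ord0 by exact: val_inj.
  rewrite sl0 sr0 ffun_cons0 ffun_consS; congr (_ *: _).
  rewrite /term linearZ /=; congr (_ *: X ord0 x _).
    apply: eq_bigr => r _.
    have -> : @slot_l k.+2 (lift ord0 r) = lift ord0 (@slot_l k.+1 r) by exact: val_inj.
    have -> : @slot_r k.+2 (lift ord0 r) = lift ord0 (@slot_r k.+1 r) by exact: val_inj.
    by rewrite !ffun_consS.
  by congr (_ v); apply: eq_bigr => s _; rewrite ffun_consS.
rewrite (partition_big (fun f : {ffun 'I_k.+1 -> 'I_n} => f ord0)
   (fun y => y \in J (lift ord0 ord0)))/=; last by move=> f /forallP.
apply: eq_bigr => y yJ; rewrite linearZ /= /chain_sum linear_sum scaler_sumr.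
by apply: eq_bigr => f /andP[_ /eqP ->].
Qed.

(** Each step multiplies the sum of the squared norms by at most [m]: the
contractions do not increase it, and the Hadamard matrices are controlled by
[hadamard_bounded]. *)
Lemma chain_sum_norm k (J : 'I_k.+1 -> {set 'I_n}) (G : 'I_k -> 'M[K]_n)
    (X : 'I_k.+1 -> 'I_n -> {linear H -> H}) :
  (forall s j u, `|X s j u| <= `|u|) -> (forall s, #|J s| = m) ->
  (forall r : 'I_k, hadamard m (J (@slot_l k.+1 r)) (J (@slot_r k.+1 r)) (G r)) ->
  \sum_(x in J ord0) `|chain_sum J G X x| ^+ 2 <= m%:R ^+ k.+1 * `|v| ^+ 2.
Proof.
elim: k J G X => [|k IHk] J G X Xc Jm GH.
  rewrite (eq_bigr (fun x => `|X ord0 x v| ^+ 2)); last first.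
    by move=> x xJ; rewrite chain_sum0.
  apply: (@le_trans _ _ (\sum_(x in J ord0) `|v| ^+ 2)).
    by apply: ler_sum => x _; rewrite lerXn2r ?nnegrE.
  by rewrite sumr_const Jm expr1 mulr_natl.
pose u := chain_sum (fun s => J (lift ord0 s)) (fun r => G (lift ord0 r))
               (fun s => X (lift ord0 s)).
apply: (@le_trans _ _ (\sum_(x in J ord0)
    `|\sum_(y in J (lift ord0 ord0)) G ord0 x y *: u y| ^+ 2)).
  by apply: ler_sum => x xJ; rewrite chain_sumS// lerXn2r ?nnegrE.
have sl0 : @slot_l k.+2 ord0 = ord0 by exact: val_inj.
have sr0 : @slot_r k.+2 ord0 = lift ord0 ord0 by exact: val_inj.
have := GH ord0; rewrite sl0 sr0 => G0.
apply: (le_trans (hadamard_bounded A u m_gt0 G0)).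
rewrite exprS -mulrA ler_pM2l ?ltr0n//; apply: IHk => // r.
have -> : lift ord0 (@slot_l k.+1 r) = @slot_l k.+2 (lift ord0 r) by exact: val_inj.
by have -> : lift ord0 (@slot_r k.+1 r) = @slot_r k.+2 (lift ord0 r) by exact: val_inj.
Qed.

Lemma norm_sum_sqr (I : {set 'I_n}) (u : 'I_n -> H) : #|I| = m ->
  `|\sum_(x in I) u x| ^+ 2 <= m%:R * \sum_(x in I) `|u x| ^+ 2.
Proof.
move=> Im; pose a x := reS `|u x|.
have aE x : inR A (a x) = `|u x| by have := inR_norm A `|u x|; rewrite normr_id.
apply: (@le_trans _ _ ((\sum_(x in I) `|u x|) ^+ 2)).
  by rewrite lerXn2r ?nnegrE ?sumr_ge0//; exact: ler_norm_sum.
under eq_bigr do rewrite -aE.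
under [in leRHS]eq_bigr do rewrite -aE -rmorphXn.
rewrite -!rmorph_sum -rmorphXn -(rmorph_nat (inR A)) -rmorphM le_inR.
set S := \sum_(x in I) a x.
have mR : 0 < m%:R :> R by rewrite ltr0n.
have : 0 <= \sum_(x in I) (m%:R * a x - S) ^+ 2 by apply: sumr_ge0 => x _; exact: sqr_ge0.
have -> : \sum_(x in I) (m%:R * a x - S) ^+ 2 =
    m%:R * (m%:R * (\sum_(x in I) a x ^+ 2) - S ^+ 2).
  rewrite (eq_bigr (fun x => m%:R ^+ 2 * a x ^+ 2 - 2 * m%:R * S * a x + S ^+ 2)); last first.
    by move=> x _; ring.
  rewrite big_split sumrB /= -!mulr_sumr -/S sumr_const Im -[_ *+ m]mulr_natl; ring.
by rewrite pmulr_rge0// subr_ge0.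
Qed.

End ChainNorm.

Section EvalBound.
Variables (R : realType) (K : scalars R) (A : scalar_theory K) (d n m : nat).
Notation idx := {ffun 'I_d -> 'I_n}.
Variables (T : {ffun 'I_d -> 'rV[K]_n} -> K) (J : 'I_d -> {set 'I_n}) (lambda : K).
Variable G : 'I_d.-1 -> 'M[K]_n.
Hypotheses (d_gt0 : (0 < d)%N) (m_gt0 : (0 < m)%N) (cardJ : forall s, #|J s| = m).
Hypothesis GH : forall r, hadamard m (J (slot_l r)) (J (slot_r r)) (G r).
Hypothesis coefE : forall i : idx, coef T i = if [forall s, i s \in J s]
  then lambda * \prod_r G r (i (slot_l r)) (i (slot_r r)) else 0.

Lemma cb_norm_chain_le : (cb_norm T <= (abs lambda * Num.sqrt (m%:R ^+ d.+1))%:E)%E.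
Proof.
apply: ge_ereal_sup => _ [H [X [Xc ->]]]; apply: ge_ereal_sup => _ [v /= v1 <-].
have Xc' s j u : `|X s j u| <= `|u| by exact: op_norm_le1.
rewrite lee_fin -(le_inR A).
have -> : inR A (reS `|eval_ops T X v|) = `|eval_ops T X v|.
  by have := inR_norm A `|eval_ops T X v|; rewrite normr_id.
suff : `|eval_ops T X v| ^+ 2 <= inR A (abs lambda * Num.sqrt (m%:R ^+ d.+1)) ^+ 2.
  by rewrite ler_pXn2r// ?nnegrE// inR_ge0 mulr_ge0 ?sqrtr_ge0 ?(abs_ge0 A).
case: d d_gt0 T J G cardJ GH coefE X Xc Xc' => // k _ T' J' G' cJ' GH' cE X Xc Xc'.
have -> : eval_ops T' X v = lambda *: \sum_(x in J' ord0) chain_sum v J' G' X x.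
  rewrite /eval_ops (bigID (fun i : {ffun 'I_k.+1 -> 'I_n} => [forall s, i s \in J' s]))/=.
  rewrite [X in _ + X]big1 ?addr0; last by move=> i /negbTE iJ; rewrite cE iJ scale0r.
  rewrite (partition_big (fun f : {ffun 'I_k.+1 -> 'I_n} => f ord0)
   (fun y => y \in J' ord0))/=; last by move=> f /forallP.
  rewrite scaler_sumr; apply: eq_bigr => x _; rewrite scaler_sumr.
  by apply: eq_bigr => i /andP[iJ _]; rewrite cE iJ scalerA.
rewrite normrZ exprMn rmorphM exprMn [inR A (abs lambda)]inR_norm.
rewrite ler_wpM2l ?exprn_ge0//.
apply: (le_trans (norm_sum_sqr A m_gt0 _ (cJ' ord0))).
rewrite -rmorphXn sqr_sqrtr ?exprn_ge0 ?ler0n// rmorphXn rmorph_nat [leRHS]exprS.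
rewrite ler_pM2l ?ltr0n//.
apply: (le_trans (chain_sum_norm A v m_gt0 Xc' cJ' GH')).
by rewrite ler_piMr ?exprn_ge0 ?ler0n// exprn_ile1.
Qed.

Lemma coef_norm_chain :
  coef_norm ((2 * d)%:R / (d + 1)%:R) T = abs lambda * Num.sqrt (m%:R ^+ d.+1).
Proof.
set q := _ / _.
have dn0 : (d != 0)%N by rewrite -lt0n.
have q0 : q != 0 by rewrite mulf_neq0 ?invr_eq0 ?pnatr_eq0 ?addn1 ?muln_eq0.
have coef_abs (i : idx) : [forall s, i s \in J s] -> abs (coef T i) = abs lambda.
  move=> /forallP iJ; rewrite coefE ifT; last exact/forallP.
  rewrite (absM A) (big_morph _ (absM A) (abs1 A)) big1 ?mulr1// => r _.
  by have [_ _ G1 _] := GH r; apply/(norm_eq1 A)/G1.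
rewrite /coef_norm (bigID (fun i : idx => [forall s, i s \in J s]))/=.
rewrite [X in _ + X]big1 ?addr0; last first.
  move=> i /negbTE iJ; rewrite coefE iJ -[reS _]/(abs 0) (abs0 A) powR0//.
rewrite (eq_bigr (fun=> abs lambda `^ q)); last first.
  by move=> i iJ; rewrite -(coef_abs i iJ).
rewrite sumr_const (card_ffun_forall (fun s x => x \in J s)).
rewrite (eq_bigr (fun=> m)); last first.
  by move=> s _; rewrite -(cardJ s); apply: eq_card.
rewrite prod_nat_const card_ord.
rewrite -[_ *+ _]mulr_natl powRM ?powR_ge0 ?ler0n// -powRrM divff// powRr1 ?(abs_ge0 A)//.
rewrite mulrC; congr (_ * _).
rewrite natrX -powR_mulrn ?ler0n// -powRrM -powR12_sqrt ?exprn_ge0 ?ler0n//.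
rewrite -powR_mulrn ?ler0n// -powRrM; congr (_ `^ _).
rewrite /q natrM natrD -[d.+1]addn1 natrD.
by field; rewrite natr1 !pnatr_eq0 dn0.
Qed.

End EvalBound.

(** * Comparison of the two norms *)

Section CoefNorm.
Variables (R : realType) (K : scalars R) (A : scalar_theory K) (d n : nat).
Notation idx := {ffun 'I_d -> 'I_n}.

(** The vanishing of the 2 by 2 minors of the slices, read on words. *)
Lemma rank_one_slices_markov (t : idx -> K) :
  (forall k a l l' r r', slice t k a l r * slice t k a l' r' =
     slice t k a l' r * slice t k a l r') -> markov_property t.
Proof.
move=> rank1 k i i' ii'.
have below_cross (j j' : idx) : below (cross k j j') k = below j k.
  by apply/ffunP => s; rewrite !ffunE; case: (s < k)%N.
have above_cross (j j' : idx) : above (cross k j j') k.+1 = above j' k.+1.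
  apply/ffunP => s; rewrite !ffunE; case ks: (k.+1 <= s)%N => //.
  by rewrite ltnNge (ltnW ks).
have cross_k (j j' : idx) : cross k j j' k = j' k by rewrite ffunE ltnn.
have := rank1 k (i k) (below i k) (below i' k) (above i k.+1) (above i' k.+1).
rewrite sliceE [in X in _ * X]ii' sliceE => ->.
have := sliceE t k (cross k i' i); rewrite below_cross above_cross cross_k => ->.
have := sliceE t k (cross k i i'); rewrite below_cross above_cross cross_k -ii' => ->.
exact: mulrC.
Qed.

Variable T : {ffun 'I_d -> 'rV[K]_n} -> K.

(** If all coefficients vanish, so does [T]: basis vectors are replaced by
arbitrary ones, one slot at a time. *)
Lemma multilinear_coef_neq0 :
  multilinear T -> (exists x, T x != 0) -> exists i, coef T i != 0.
Proof.
move=> Tlin [x Tx]; apply/not_existsP => coef0.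
have {}coef0 i : coef T i = 0 by apply/eqP/negPn/negP; exact: coef0.
suff T0 k (y : {ffun 'I_d -> 'rV[K]_n}) :
    (forall s : 'I_d, (k <= s)%N -> exists j, y s = delta_mx 0 j) -> T y = 0.
  by move: Tx; rewrite (T0 d) ?eqxx// => s; rewrite leqNgt ltn_ord.
elim: k y => [|k IHk] y ydelta.
  have /fin_all_exists[i yi] : forall s, exists j, y s = delta_mx 0 j.
    by move=> s; exact: ydelta.
  rewrite -(coef0 [ffun s => i s]); congr T; apply/ffunP => s; rewrite !ffunE; exact: yi.
have [kd|dk] := ltnP k d; last first.
  by apply: IHk => s ks; have := leq_ltn_trans (leq_trans dk ks) (ltn_ord s); rewrite ltnn.
pose s0 := Ordinal kd.
pose f (v : 'rV[K]_n) := T [ffun s => if s == s0 then v else y s].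
have flin : scalar f by exact: Tlin.
have f0 : f 0 = 0.
  have := flin 1 0 0; rewrite scaler0 addr0 mul1r => f00.
  by apply: (addrI (f 0)); rewrite -f00 addr0.
have -> : T y = f (y s0).
  by congr T; apply/ffunP => s; rewrite ffunE; case: eqVneq => [->|].
rewrite [y s0]row_sum_delta; elim/big_rec: _ => // j v _ fv.
rewrite flin fv addr0; suff -> : f (delta_mx 0 j) = 0 by rewrite mulr0.
apply: IHk => s ks; rewrite ffunE; case: eqVneq => [_|ss0]; first by exists j.
by apply: ydelta; rewrite ltn_neqAle ks andbT; move: ss0; rewrite -val_eqE eq_sym.
Qed.

Let x (i : idx) : R := abs (coef T i).
Let x_ge0 i : 0 <= x i. Proof. exact: abs_ge0. Qed.

Lemma sum_slot_norm_le (C : R) : (cb_norm T <= C%:E)%E ->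
  forall k, \sum_a slot_norm x k a <= C.
Proof. by move=> cbC k; exact: (sum_slot_le A cbC). Qed.

Hypothesis (d_gt0 : (0 < d)%N) (coef_neq0 : exists i, coef T i != 0).

(** Some slice is nonzero, so the bound attached to a slot is positive.  This
also excludes the value [-oo]. *)
Lemma cb_norm_bound_gt0 (C : R) : (cb_norm T <= C%:E)%E -> 0 < C.
Proof.
case: coef_neq0 => i Ti /sum_slot_norm_le/(_ (Ordinal d_gt0)); apply: lt_le_trans.
rewrite (bigD1 (i (Ordinal d_gt0)))//= ltr_pwDl ?sumr_ge0// => [|*]; last exact: slot_norm_ge0.
rewrite lt_def slot_norm_ge0 andbT; apply: contra_neq Ti => /slot_norm_eq0 xi.
by apply/eqP; rewrite -(abs_eq0 A) -/(x i) xi.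
Qed.

Let q : R := (2 * d)%:R / (d + 1)%:R.

Lemma q_gt0 : 0 < q.
Proof. by rewrite divr_gt0// ltr0n ?addn1// muln_gt0. Qed.

Lemma coef_norm_powR : coef_norm q T `^ q = \sum_i x i `^ q.
Proof.
rewrite /coef_norm -powRrM mulVf ?gt_eqF ?q_gt0// powRr1//.
by apply: sumr_ge0 => i _; exact: powR_ge0.
Qed.

Lemma coef_norm_le_bound (C : R) : (cb_norm T <= C%:E)%E -> coef_norm q T <= C.
Proof.
move=> cbC; have C0 := cb_norm_bound_gt0 cbC.
have := blei_le x_ge0 C0 (sum_slot_norm_le cbC); rewrite -/q -coef_norm_powR.
apply: contraTT; rewrite -!ltNge => Clt; apply: gt0_ltr_powR => //.
- exact: q_gt0.
- by rewrite nnegrE ltW.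
- by rewrite nnegrE; exact: powR_ge0.
Qed.

Lemma coef_norm_le_cb_norm : ((coef_norm q T)%:E <= cb_norm T)%E.
Proof.
case E : (cb_norm T) => [r| |].
- by rewrite lee_fin; apply: coef_norm_le_bound; rewrite E.
- exact: leey.
- have cb0 : (cb_norm T <= (0 : R)%:E)%E by rewrite E leNye.
  by have := cb_norm_bound_gt0 cb0; rewrite ltxx.
Qed.

End CoefNorm.

Theorem theoremA (R : realType) (K : scalars R)
    (hK : K = real_scalars R \/ K = complex_scalars R)
    (d n : nat) (hd : (2 <= d)%N) (hn : (1 <= n)%N)
    (T : {ffun 'I_d -> 'rV[K]_n} -> K)
    (T_multilinear : multilinear T) (T_neq0 : exists x, T x != 0) :
  (coef_norm ((2 * d)%:R / (d + 1)%:R) T)%:E = cb_norm T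
  <->
  exists (m : nat) (J : 'I_d -> {set 'I_n}) (lambda : K)
         (G : 'I_d.-1 -> 'M[K]_n),
    [/\ (1 <= m <= n)%N,
        forall s : 'I_d, #|J s| = m,
        lambda != 0,
        forall r : 'I_d.-1, hadamard m (J (slot_l r)) (J (slot_r r)) (G r)
      & forall i : {ffun 'I_d -> 'I_n},
          coef T i =
          if [forall s, i s \in J s]
          then lambda * \prod_(r < d.-1) G r (i (slot_l r)) (i (slot_r r))
          else 0].
Proof.
have [A] : inhabited (scalar_theory K).
  by case: hK => ->; constructor; [exact: real_scalar_theory | exact: complex_scalar_theory].
have d_gt0 : (0 < d)%N by rewrite (leq_trans _ hd).
have coef_neq0 := multilinear_coef_neq0 T_multilinear T_neq0.
set q := _ / _; split; last first.
  move=> [m [J [lambda [G [/andP[m0 mn] Jm l0 GH coefE]]]]].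
  apply/eqP; rewrite eq_le coef_norm_le_cb_norm//=.
  by rewrite (coef_norm_chain A d_gt0 Jm GH coefE) (cb_norm_chain_le A d_gt0 m0 Jm GH coefE).
move=> norm_eq; pose C := coef_norm q T; pose x i := abs (coef T i).
have cbC : (cb_norm T <= C%:E)%E by rewrite -norm_eq.
have C_gt0 := cb_norm_bound_gt0 A d_gt0 coef_neq0 cbC.
have x_ge0 i : 0 <= x i by exact: abs_ge0.
have xC := sum_slot_norm_le A cbC.
have xq : \sum_i x i `^ q = C `^ q by rewrite coef_norm_powR.
have [sumC _] := blei_eq x_ge0 C_gt0 xC xq.
have Tmarkov : markov_property (coef T).
  by apply: rank_one_slices_markov => k; exact: (sum_slot_eq A cbC (sumC k)).
have xn0 : exists i, x i != 0.
  by case: coef_neq0 => i Ti; exists i; rewrite (abs_eq0 A).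
have [m [J [c [m0 Jm c0 Cc xE]]]] := blei_eq_structure hd x_ge0 C_gt0 xC xn0 xq.
have absT (i : {ffun 'I_d -> 'I_n}) : [forall s, i s \in J s] -> abs (coef T i) = c.
  by move=> iJ; have := xE i; rewrite iJ.
have [a aJ] : exists a : {ffun 'I_d -> 'I_n}, [forall s, a s \in J s].
  case: coef_neq0 => a Ta; exists a; apply: contraTT Ta => /negbTE aJ.
  by rewrite negbK -(abs_eq0 A) -/(x a) xE aJ.
have Tn0 (i : {ffun 'I_d -> 'I_n}) : [forall s, i s \in J s] -> coef T i != 0.
  by move=> /absT Ti; rewrite -(abs_eq0 A) Ti gt_eqF.
have updJ (i : {ffun 'I_d -> 'I_n}) s y : [forall s, i s \in J s] -> y \in J s ->
    [forall s', update i s y s' \in J s'].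
  move=> /forallP iJ yJ; apply/forallP => s'; rewrite ffunE.
  by case: eqVneq => [->//|_]; exact: iJ.
pose G := transition (coef T) a.
have coefE (i : {ffun 'I_d -> 'I_n}) : coef T i = if [forall s, i s \in J s]
    then coef T a * \prod_r G r (i (slot_l r)) (i (slot_r r)) else 0.
  case: ifP => iJ; first exact: (markov_factorization hd Tmarkov Tn0 aJ iJ).
  by apply/eqP; rewrite -(abs_eq0 A) -/(x i) xE iJ.
have abs_G r y z : y \in J (slot_l r) -> z \in J (slot_r r) -> abs (G r y z) = 1.
  move=> yJ zJ; rewrite mxE (absM A) (absV A) absT; last by apply: (updJ) => //; exact: updJ.
  have -> : abs (if (r == 0 :> nat)%N then coef T a else coef T (update a (slot_l r) y)) = c.
    by case: ifP => _; apply: absT => //; exact: updJ.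
  by rewrite divff// gt_eqF.
exists m, J, (coef T a), G; split=> //.
- by rewrite m0 -(Jm (Ordinal d_gt0)) -[X in (_ <= X)%N]card_ord max_card.
- exact: Tn0.
- move=> r; pose code (y : 'I_n) : pword d n := [ffun=> Some y].
  have code_inj : injective code.
    by move=> y z /ffunP/(_ (Ordinal d_gt0)); rewrite !ffunE => -[].
  apply: (hadamard_of_pairing A code_inj) => // [y z|xv yv]; first exact: abs_G.
  exact: (chain_pairing_le A m0 Jm cbC C_gt0 c0 Cc (absT a aJ) abs_G coefE).
Qed.
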